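(* Let $(X,\|\cdot\|)$ be a Banach space, $Y\subset X$ a closed linear subspace and $D\subset X^*$ a set induced by a $1$-projectional skeleton in $X$. Then the following conditions are equivalent: (i) $D\upharpoonright_Y$ is induced by a $1$-projectional skeleton in $Y$. (ii) $D\upharpoonright_Y\cap B_{Y^*}$ is induced by a retractional skeleton in $(B_{Y^*},w^* )$. (iii) $Y$ is $\sigma(X,D)$-closed in $X$. (iv) $\beta((D\cap B_{X^*})\upharpoonright_Y,w^* )=(B_{Y^*},w^* )$ and $((D\cap B_{X^*})\upharpoonright_Y,w^* )$ is a Fréchet–Urysohn space. (v) $\beta((D\cap B_{X^*})\upharpoonright_Y,w^* )=(B_{Y^*},w^* )$ and the map $R:d\mapsto d\upharpoonright_Y$ is a quotient mapping of $(D\cap B_{X^*},w^* )$ onto its image in $(B_{Y^*},w^* )$.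
   Context: All topological spaces are Hausdorff; Banach spaces are real. $B_X$ denotes the closed unit ball of a Banach space $X$; $w^*$ is the weak$^*$ topology (of $X^*$ or $Y^*$ respectively). For $A\subset X^*$, $A\upharpoonright_Y=\{a\upharpoonright_Y: a\in A\}\subset Y^*$. $\sigma(X,D)$ is the weakest topology on $X$ making every functional in $D$ continuous. $\beta T$ is the Stone–Čech compactification of $T$; ''$\beta T=L$'' for a subset $T$ of a compact space $L$ means that $L$, together with the inclusion $T\subset L$, is the Stone–Čech compactification of $T$. A space $T$ is Fréchet–Urysohn if for every $A\subset T$ and $x\in\overline{A}$ there is a sequence in $A$ converging to $x$. A partially ordered set $\Gamma$ is up-directed if any two elements have an upper bound in $\Gamma$, and $\sigma$-complete if every increasing sequence in $\Gamma$ has a supremum in $\Gamma$. A projectional skeleton in a Banach space $X$ is a family $\{P_s\}_{s\in\Gamma}$ of bounded linear projections on $X$, indexed by an up-directed $\sigma$-complete partially ordered set $\Gamma$, such that: (i) each $P_sX$ is separable; (ii) $X=\bigcup_{s\in\Gamma}P_sX$; (iii) $s\le t\Rightarrow P_s=P_s\circ P_t=P_t\circ P_s$; (iv) if $s_1<s_2<\cdots$ in $\Gamma$ and $t=\sup_n s_n$, then $P_tX=\overline{\bigcup_n P_{s_n}X}$. It is an $r$-projectional skeleton ($r\ge1$) if moreover $\|P_s\|\le r$ for all $s\in\Gamma$. The set induced by the projectional skeleton is $\bigcup_{s\in\Gamma}P_s^*[X^*]\subset X^*$. A retractional skeleton in a compact space $K$ is a family $\{r_s\}_{s\in\Gamma}$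 of (continuous) retractions of $K$ into itself, indexed by an up-directed $\sigma$-complete partially ordered set $\Gamma$, such that: (i) $r_s[K]$ is metrizable for each $s$; (ii) $x=\lim_{s\in\Gamma}r_s(x)$ for every $x\in K$; (iii) $s\le t\Rightarrow r_s=r_s\circ r_t=r_t\circ r_s$; (iv) if $s_1<s_2<\cdots$ in $\Gamma$ and $t=\sup_n s_n$, then $r_t(x)=\lim_n r_{s_n}(x)$ for every $x\in K$. The set induced by this retractional skeleton is $\bigcup_{s\in\Gamma}r_s[K]$. *)

(* Defs.v *)
From HB Require Import structures.
From mathcomp Require Import all_boot all_order all_algebra.
From mathcomp Require Import all_classical all_reals all_analysis.

Set Implicit Arguments.
Unset Strict Implicit.
Unset Printing Implicit Defensive.

Import Order.TTheory GRing.Theory Num.Theory.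
Import numFieldNormedType.Exports.

Local Open Scope classical_set_scope.
Local Open Scope ring_scope.

Section General_topology.

(* Below, [set_type A] carries the subspace topology, by the library's
   instance for subsets of topological spaces. *)

Definition separable (T : topologicalType) : Prop :=
  exists2 C : set T, countable C & dense C.

Definition metrizable (R : realType) (T : topologicalType) : Prop :=
  exists d : T -> T -> R,
    [/\ forall x y, d x y = 0 <-> x = y,
        forall x y, d x y = d y x,
        forall x y z, d x z <= d x y + d y z
      & forall (x : T) (A : set T),
          nbhs x A <-> exists2 e : R, 0 < e & [set y | d x y < e] `<=` A].

Definition frechet_urysohn (T : topologicalType) : Prop :=
  forall (A : set T) (x : T), closure A x ->
    exists2 u : nat -> T, forall n, A (u n) & u @ \oo --> x.

(* [L], with the inclusion of [T], is the Stone-Cech compactification of [T].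
   Uniqueness of the extension [g] follows from the density of [T]. *)
Definition stone_cech (L : topologicalType) (T : set L) : Prop :=
  [/\ compact [set: L], hausdorff_space L, dense T
    & forall (C : topologicalType) (f : set_type T -> C),
        compact [set: C] -> hausdorff_space C -> continuous f ->
        exists2 g : L -> C, continuous g & forall t : set_type T, g (set_val t) = f t].

Definition quotient_map (S T : topologicalType) (q : S -> T) : Prop :=
  range q = [set: T] /\ forall U : set T, open U <-> open (q @^-1` U).

Definition corestrict (S : Type) (T : Type) (f : S -> T) (x : S) :
    set_type (range f) :=
  exist _ (f x) (mem_set (imageT f x)).

Definition quotient_onto_image (S T : topologicalType) (f : S -> T) : Prop :=
  quotient_map (corestrict f).

End General_topology.

Section Directed_sets.
Context {disp : Order.disp_t} (G : porderType disp).
Local Open Scope order_scope.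

Definition up_directed : Prop := forall s t : G, exists u : G, s <= u /\ t <= u.

Definition is_supremum (s : nat -> G) (t : G) : Prop :=
  (forall n, s n <= t) /\ (forall u, (forall n, s n <= u) -> t <= u).

Definition sigma_complete : Prop :=
  forall s : nat -> G, (forall n, s n <= s n.+1) -> exists t, is_supremum s t.

Definition strictly_increasing (s : nat -> G) : Prop := forall n, s n < s n.+1.

(* The filter of tails of [G], along which limits of nets are taken. *)
Definition tails : set_system G :=
  filter_from [set: G] (fun s => [set t | s <= t]).

End Directed_sets.

Arguments tails {disp} G.

Section Bounded_operators.
Context {R : realType}.

Record bounded_op (V W : normedModType R) := BoundedOp {
  bounded_op_fun :> {linear V -> W} ;
  bounded_op_continuous : continuous bounded_op_fun
}.

Definition opnorm (V W : normedModType R) (f : V -> W) : \bar R :=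
  ereal_sup [set `|f x|%:E | x in [set x : V | `|x| <= 1]].

Definition dual (V : normedModType R) : Type := bounded_op V R^o.

Definition dual_fun (V : normedModType R) (f : dual V) : {ptws V -> R^o} := f.

HB.instance Definition _ (V : normedModType R) := gen_eqMixin (dual V).
HB.instance Definition _ (V : normedModType R) := gen_choiceMixin (dual V).

(* The topology of [dual V] is the weak* one, not the one of the norm. *)
HB.instance Definition _ (V : normedModType R) :=
  Topological.copy (dual V) (initial_topology (@dual_fun V)).

Definition dual_ball (V : normedModType R) : set (dual V) :=
  [set f | (opnorm f <= 1)%E].

Lemma comp_continuous (U V W : normedModType R)
    (g : bounded_op V W) (f : bounded_op U V) : continuous (g \o f).
Proof.
by move=> x; apply: continuous_comp; exact: bounded_op_continuous.
Qed.

Definition comp_op (U V W : normedModType R)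
    (g : bounded_op V W) (f : bounded_op U V) : bounded_op U W :=
  @BoundedOp U W (g \o f : {linear U -> W}) (@comp_continuous U V W g f).

Definition adjoint (V W : normedModType R) (T : bounded_op V W) :
    dual W -> dual V :=
  fun f => comp_op f T.

(* sigma(X, D), defined on a copy of X as the supremum of the topologies
   pulled back along the functionals of D. *)
Definition sigma_space (X : normedModType R) (D : set (dual X)) : Type := X.

HB.instance Definition _ (X : normedModType R) (D : set (dual X)) :=
  Topological.copy (sigma_space D)
    (sup_topology (fun d : set_type D =>
       Topological.class (initial_topology (set_val d : X -> R^o)))).

Definition sigma_closed (X : normedModType R) (D : set (dual X)) (A : set X) :
    Prop :=
  @closed (sigma_space D) A.

End Bounded_operators.

Arguments dual_ball {R} V.

Section Isometries.
Context {R : realType} {V W : normedModType R}.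

Lemma isometry_cvg (f : V -> W) (F : set_system V) (x : V) :
  Filter F -> (forall y z, `|f y - f z| = `|y - z|) ->
  f @ F --> f x <-> F --> x.
Proof.
move=> FF fE; split=> [/cvgrPdist_lt Fx|/cvgrPdist_lt Fx];
  apply/cvgrPdist_lt => e e0; have := Fx e e0; apply: filterS => z;
  by rewrite fE.
Qed.

Lemma isometry_cauchy (f : V -> W) (F : set_system V) :
  Filter F -> (forall y z, `|f y - f z| = `|y - z|) -> cauchy F ->
  cauchy (f @ F).
Proof.
move=> FF fE /cauchy_ballP Fc; apply/cauchy_ballP => e e0.
have := Fc e e0; rewrite !near2E => -[[A B] /= [FA FB] AB].
exists (f @` A, f @` B) => /=.
  by split; [apply: filterS FA|apply: filterS FB] => y ?; exists y.
move=> [_ _] /= [[a Aa <-] [b Bb <-]]; have := AB (a, b) (conj Aa Bb).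
by rewrite -!ball_normE /= fE.
Qed.

End Isometries.

Section Closed_subspaces.
Context {R : realType} (X : completeNormedModType R).

Record closed_subspace := ClosedSubspace {
  carrier :> set X ;
  carrier_linear : submod_closed (fun x => x \in carrier) ;
  carrier_closed : closed carrier
}.

Variable Y : closed_subspace.

Definition subspace_pred : {pred X} := fun x => x \in carrier Y.

HB.instance Definition _ := GRing.isSubmodClosed.Build R X subspace_pred
  (carrier_linear Y).

(* [Y] as a Banach space, with the norm of [X]. *)
Definition subspace_type : Type := {x : X | subspace_pred x}.

HB.instance Definition _ := [isSub of subspace_type for @sval X subspace_pred].
HB.instance Definition _ := [Choice of subspace_type by <:].
HB.instance Definition _ := [SubChoice_isSubLmodule of subspace_type by <:].

Let norm (y : subspace_type) : R := `|val y|.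

Let norm_triangle y z : norm (y + z) <= norm y + norm z.
Proof. exact: ler_normD. Qed.

Let normZ (l : R) y : norm (l *: y) = `|l| * norm y.
Proof. exact: normrZ. Qed.

Let norm_eq0 y : norm y = 0 -> y = 0.
Proof. by move=> /normr0_eq0 y0; exact: val_inj. Qed.

HB.instance Definition _ :=
  @Lmodule_isNormed.Build R subspace_type norm norm_triangle normZ norm_eq0.

End Closed_subspaces.

Section Closed_subspaces_complete.
Context {R : realType} {X : completeNormedModType R} (Y : closed_subspace X).
Local Notation subspace_type := (subspace_type Y).

Lemma subspace_valB (y z : subspace_type) : `|val y - val z| = `|y - z|.
Proof. by rewrite -raddfB. Qed.

Lemma subspace_val_continuous : continuous (val : subspace_type -> X).
Proof.
move=> y.
by have [_] := @isometry_cvg R subspace_type X val (nbhs y) y _ subspace_valB;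
  exact.
Qed.

Definition subspace_incl : bounded_op subspace_type X :=
  @BoundedOp R subspace_type X (val : {linear subspace_type -> X})
    subspace_val_continuous.

Lemma subspace_complete (F : set_system subspace_type) :
  ProperFilter F -> cauchy F -> cvg F.
Proof.
move=> FF Fc.
have FFl : Filter F by exact: FF.
have GF : ProperFilter (val @ F) by exact: fmap_proper_filter.
have /cvg_ex[x Gx] := @cauchy_cvg _ _ GF (isometry_cauchy FFl subspace_valB Fc).
have Yx : subspace_pred Y x.
  apply/mem_set/(@carrier_closed _ _ Y x) => A /Gx FA.
  have [y Ay] := @filter_ex _ F _ (val @^-1` A) FA.
  by exists (val y); split => //; exact/set_mem/(valP y).
by apply/cvg_ex; exists (Sub x Yx); apply: (isometry_cvg _ FFl subspace_valB).1.
Qed.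

HB.instance Definition _ :=
  Uniform_isComplete.Build subspace_type subspace_complete.

End Closed_subspaces_complete.

Section Skeletons.
Context {R : realType}.

Record projectional_skeleton (X : completeNormedModType R)
    (disp : Order.disp_t) (G : porderType disp) (P : G -> bounded_op X X) :
    Prop := {
  ps_directed : up_directed G ;
  ps_sigma_complete : sigma_complete G ;
  ps_projection : forall s x, P s (P s x) = P s x ;
  ps_separable : forall s, separable (set_type (range (P s))) ;
  ps_cover : \bigcup_s range (P s) = [set: X] ;
  ps_commute : forall s t, (s <= t)%O ->
    forall x, P s x = P s (P t x) /\ P s x = P t (P s x) ;
  ps_continuous : forall (s : nat -> G) (t : G),
    strictly_increasing s -> is_supremum s t ->
    range (P t) = closure (\bigcup_n range (P (s n)))
}.

Definition r_projectional_skeleton (r : R) (X : completeNormedModType R)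
    (disp : Order.disp_t) (G : porderType disp) (P : G -> bounded_op X X) :
    Prop :=
  projectional_skeleton P /\ forall s, (opnorm (P s) <= r%:E)%E.

Definition induced_by_projections (X : completeNormedModType R)
    (G : Type) (P : G -> bounded_op X X) : set (dual X) :=
  \bigcup_s range (adjoint (P s)).

Definition induced_by_r_projectional_skeleton (r : R)
    (X : completeNormedModType R) (D : set (dual X)) : Prop :=
  exists (disp : Order.disp_t) (G : porderType disp) (P : G -> bounded_op X X),
    r_projectional_skeleton r P /\ D = induced_by_projections P.

Record retractional_skeleton (K : topologicalType)
    (disp : Order.disp_t) (G : porderType disp) (r : G -> K -> K) :
    Prop := {
  rs_directed : up_directed G ;
  rs_sigma_complete : sigma_complete G ;
  rs_continuous_map : forall s, continuous (r s) ;
  rs_retraction : forall s x, r s (r s x) = r s x ;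
  rs_metrizable : forall s, metrizable R (set_type (range (r s))) ;
  rs_limit : forall x, r s x @[s --> tails G] --> x ;
  rs_commute : forall s t, (s <= t)%O ->
    forall x, r s x = r s (r t x) /\ r s x = r t (r s x) ;
  rs_continuous : forall (s : nat -> G) (t : G),
    strictly_increasing s -> is_supremum s t ->
    forall x, r (s n) x @[n --> \oo] --> r t x
}.

Definition induced_by_retractions (K : Type) (G : Type) (r : G -> K -> K) :
    set K :=
  \bigcup_s range (r s).

Definition induced_by_retractional_skeleton (K : topologicalType)
    (A : set K) : Prop :=
  exists (disp : Order.disp_t) (G : porderType disp) (r : G -> K -> K),
    retractional_skeleton r /\ A = induced_by_retractions r.

End Skeletons.

Section Restrictions.
Context {R : realType} {X : completeNormedModType R} (Y : closed_subspace X).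

Definition restriction : dual X -> dual (subspace_type Y) :=
  adjoint (subspace_incl Y).

Lemma restriction_dual_ball :
  restriction @` dual_ball X `<=` dual_ball (subspace_type Y).
Proof.
move=> _ [f fB <-]; apply: le_trans fB.
by apply: ereal_sup_le => _ [y yB <-]; exists (val y).
Qed.

End Restrictions.

(* The unit ball of the dual, with the weak* topology. *)
Definition dual_ball_space {R : realType} (V : normedModType R) :
    topologicalType :=
  set_type (dual_ball V).

(* The trace of [A] on the unit ball, as a subset of the space above. *)
Definition in_dual_ball {R : realType} {V : normedModType R}
    (A : set (dual V)) : set (dual_ball_space V) :=
  set_val @^-1` A.

(* Main.v *)
From HB Require Import structures.
Require Import Defs.
From mathcomp Require Import all_boot all_order all_algebra.
From mathcomp Require Import all_classical all_reals all_analysis.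
From mathcomp Require Import lra.

(** The cycle proved is (i), (ii), (iv), (v), (iii), (i). Write B for the dual
    ball of X, S for the trace of the restriction of D on the dual ball K of Y,
    and F for the functionals in D that vanish on Y.

    (i) gives (ii): the adjoints of the projections are weak* continuous
    retractions of K (ball_retractional_skeleton). Their ranges are metrizable
    because a functional in such a range is determined by its values on a
    sequence dense in the range of the projection.

    (ii) gives (iv): two arguments about an arbitrary retractional skeleton
    build an increasing sequence of indices together with a sequence of points
    and compare cluster points inside the range of the retraction at the
    supremum. They show that the induced set is Frechet-Urysohn
    (induced_frechet_urysohn) and that a real continuous function on it factors
    through one retraction (induced_factorization), hence extends to K. Maps
    into a compact Hausdorff space extend because real functions determine its
    topology (induced_stone_cech). Finally the intersection of D and B is
    countably compact, and its restriction to Y is dense in K. As a countably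
    compact subset of the Frechet-Urysohn space S is closed in S, this
    restriction is all of S (restricted_ball_eq).

    (iv) gives (v): a continuous map from a countably compact space onto a
    Hausdorff Frechet-Urysohn space is a quotient map
    (frechet_urysohn_quotient).

    (v) gives (iii): let x be in the sigma(X, D)-closure of Y. Then d x depends
    only on the restriction of d to Y, for d in D and B. By the quotient
    property this is a continuous function on the restrictions, so it extends
    to a continuous h on K. By density h takes the value f x at the restriction
    of f, for every f in B. In particular f x = 0 as soon as f vanishes on Y,
    and the Hahn-Banach theorem puts x in Y (quotient_sigma_closed).

    (iii) gives (i): as Y is sigma(X, D)-closed, it is the common kernel of F
    (sigma_closed_separation). A closing-off argument yields cofinally many
    indices t for which P t maps Y into Y (invariant_cofinal); for such t the
    projections restrict to Y and form a skeleton there.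

    The Hahn-Banach theorem is obtained from minimal sublinear functionals
    (mazur_orlicz), and weak* compactness from pointwise ultrafilter limits
    (banach_alaoglu). *)

Set Implicit Arguments.
Unset Strict Implicit.
Unset Printing Implicit Defensive.

Import Order.TTheory GRing.Theory Num.Theory.
Import numFieldNormedType.Exports.

Local Open Scope classical_set_scope.
Local Open Scope ring_scope.

(** * The Mazur-Orlicz form of the Hahn-Banach theorem *)

Section Mazur_Orlicz.
Context {R : realType} {V : lmodType R}.

Definition sublinear (p : V -> R) : Prop :=
  (forall x y, p (x + y) <= p x + p y) /\
  (forall (a : R) x, 0 <= a -> p (a *: x) <= a * p x).

Definition convex_cone (C : set (V * R)) : Prop :=
  [/\ C (0, 0),
      forall z w, C z -> C w -> C (z.1 + w.1, z.2 + w.2)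
    & forall (a : R) z, 0 <= a -> C z -> C (a *: z.1, a * z.2)].

Lemma sublinear0 p : sublinear p -> p 0 = 0.
Proof.
move=> [pD pZ]; have := pD 0 0; have := pZ 0 0 (lexx 0).
by rewrite scale0r mul0r addr0; lra.
Qed.

Lemma sublinear_opp p x : sublinear p -> - p (- x) <= p x.
Proof. by move=> ps; have := ps.1 x (- x); rewrite subrr sublinear0//; lra. Qed.

Lemma sublinearZ p (a : R) x : sublinear p -> 0 <= a -> p (a *: x) = a * p x.
Proof.
move=> ps a0; have [->|a_neq0] := eqVneq a 0.
  by rewrite scale0r mul0r (sublinear0 ps).
have a_gt0 : 0 < a by rewrite lt_neqAle eq_sym a_neq0.
apply/eqP; rewrite eq_le ps.2//= mulrC -ler_pdivlMr// mulrC.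
have := ps.2 a^-1 (a *: x); rewrite scalerA mulVf// scale1r; apply.
by rewrite invr_ge0.
Qed.

(** The largest sublinear functional that is dominated by [p] and takes at [z]
    a value at most [c], for every pair [(z, c)] of the cone. *)
Definition lower_by (p : V -> R) (C : set (V * R)) (x : V) : R :=
  inf [set p (x - z.1) + z.2 | z in C].

Lemma lower_by_lb p C : sublinear p ->
  (forall z, C z -> - p (- z.1) <= z.2) ->
  forall x, lbound [set p (x - z.1) + z.2 | z in C] (- p (- x)).
Proof.
move=> ps Cp x _ [z Cz <-].
have := ps.1 (x - z.1) (- x); rewrite addrAC subrr sub0r.
by have := Cp _ Cz; lra.
Qed.

Lemma lower_by_le p C : sublinear p -> convex_cone C ->
  (forall z, C z -> - p (- z.1) <= z.2) ->
  forall x z, C z -> lower_by p C x <= p (x - z.1) + z.2.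
Proof.
move=> ps CC Cp x z Cz; apply: ge_inf; last by exists z.
by exists (- p (- x)); exact: lower_by_lb.
Qed.

Lemma lower_by_sublinear p C : sublinear p -> convex_cone C ->
  (forall z, C z -> - p (- z.1) <= z.2) -> sublinear (lower_by p C).
Proof.
move=> ps CC Cp; have [C0 CD CZ] := CC.
have ne x : [set p (x - z.1) + z.2 | z in C] !=set0.
  by exists (p (x - 0) + 0), (0, 0).
split=> [x y|a x a0].
  rewrite -lerBlDr; apply: (lb_le_inf (ne x)) => _ [z Cz <-].
  rewrite lerBlDr -lerBlDl; apply: (lb_le_inf (ne y)) => _ [w Cw <-].
  rewrite lerBlDr; have := lower_by_le ps CC Cp (x + y) (CD _ _ Cz Cw).
  have := ps.1 (x - z.1) (y - w.1).
  by rewrite /= opprD addrACA; lra.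
have [->|a_neq0] := eqVneq a 0.
  rewrite scale0r mul0r; have := lower_by_le ps CC Cp 0 C0.
  by rewrite /= subr0 addr0 (sublinear0 ps).
have a_gt0 : 0 < a by rewrite lt_neqAle eq_sym a_neq0.
rewrite mulrC -ler_pdivrMr//; apply: (lb_le_inf (ne x)) => _ [z Cz <-].
rewrite ler_pdivrMr// mulrDl.
have := lower_by_le ps CC Cp (a *: x) (CZ _ _ a0 Cz).
have := ps.2 a (x - z.1) a0.
by rewrite /= scalerBr; lra.
Qed.

Lemma lower_by_dom p C : sublinear p -> convex_cone C ->
  (forall z, C z -> - p (- z.1) <= z.2) -> forall x, lower_by p C x <= p x.
Proof.
move=> ps CC Cp x; have [C0 _ _] := CC.
by have := lower_by_le ps CC Cp x C0; rewrite /= subr0 addr0.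
Qed.

Lemma lower_by_cone p C : sublinear p -> convex_cone C ->
  (forall z, C z -> - p (- z.1) <= z.2) ->
  forall z, C z -> lower_by p C z.1 <= z.2.
Proof.
move=> ps CC Cp z Cz.
by have := lower_by_le ps CC Cp z.1 Cz; rewrite subrr (sublinear0 ps) add0r.
Qed.

(** Each [q x] is at least [- p0 (- x)], so the infimum is finite. For
    subadditivity at [x] and [y], the smaller of two members of the chain serves
    at both points. *)
Lemma chain_inf_sublinear (p0 : V -> R) (A : set (V -> R)) :
  A !=set0 -> (forall q, A q -> sublinear q /\ forall x, q x <= p0 x) ->
  (forall q r, A q -> A r -> (forall x, q x <= r x) \/ (forall x, r x <= q x)) ->
  let m := fun x => inf [set q x | q in A] in
  sublinear m /\ forall q x, A q -> m x <= q x.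
Proof.
move=> [q0 Aq0] As Atot m.
have ne x : [set q x | q in A] !=set0 by exists (q0 x), q0.
have mle q x : A q -> m x <= q x.
  move=> Aq; apply: ge_inf; last by exists q.
  exists (- p0 (- x)) => _ [r Ar <-].
  have [rs rp] := As _ Ar; have := sublinear_opp x rs; have := rp (- x); lra.
split=> //; split=> [x y|a x a0].
  rewrite -lerBlDr; apply: lb_le_inf => // _ [q Aq <-].
  rewrite lerBlDr -lerBlDl; apply: lb_le_inf => // _ [r Ar <-].
  rewrite lerBlDr; have [qs _] := As _ Aq; have [rs _] := As _ Ar.
  case: (Atot _ _ Aq Ar) => [/(_ y) ?|/(_ x) ?].
    by have := mle q (x + y) Aq; have := qs.1 x y; lra.
  by have := mle r (x + y) Ar; have := rs.1 x y; lra.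
have [->|a_neq0] := eqVneq a 0.
  rewrite scale0r mul0r; have := mle _ 0 Aq0.
  by rewrite (sublinear0 (As _ Aq0).1).
have a_gt0 : 0 < a by rewrite lt_neqAle eq_sym a_neq0.
rewrite mulrC -ler_pdivrMr//; apply: lb_le_inf => // _ [q Aq <-].
rewrite ler_pdivrMr// mulrC; have [qs _] := As _ Aq.
exact: le_trans (mle _ _ Aq) (qs.2 _ _ a0).
Qed.

Lemma minimal_sublinear (p : V -> R) : sublinear p ->
  exists q, [/\ sublinear q, forall x, q x <= p x
    & forall r, sublinear r -> (forall x, r x <= q x) -> r = q].
Proof.
move=> ps; pose T := {q : V -> R | sublinear q /\ forall x, q x <= p x}.
pose le (s t : T) : bool := `[< forall x, sval t x <= sval s x >].
have [||||q qmax] := @Zorn T le.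
- by move=> t; apply/asboolP => x.
- move=> r s t /asboolP rs /asboolP st; apply/asboolP => x.
  exact: le_trans (st x) (rs x).
- move=> [s hs] [t ht] /asboolP st /asboolP ts; apply: eq_exist => /=.
  by apply/funext => x; apply/eqP; rewrite eq_le (ts x) (st x).
- move=> A Atot; have [->|/set0P[q0 Aq0]] := eqVneq A set0.
    exists (exist _ p (conj ps (fun x => lexx (p x)))).
    by move=> s [].
  have [|||ms mle] := @chain_inf_sublinear p (sval @` A).
  - by exists (sval q0), q0.
  - by move=> _ [[q hq] _ <-].
  - move=> _ _ [s As <-] [t At <-].
    by have [/asboolP|/asboolP] := Atot _ _ As At; [right|left].
  set m := fun x : V => inf _ in ms mle.
  have mp : sublinear m /\ forall x, m x <= p x.
    split=> // x; have /mle : (sval @` A) (sval q0) by exists q0.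
    by move=> /(_ x) /le_trans; apply; exact: (svalP q0).2.
  exists (exist _ m mp) => s As; apply/asboolP => x /=; apply: mle.
  by exists s.
exists (sval q); split; [exact: (svalP q).1|exact: (svalP q).2|] => r rs rq.
have rp : sublinear r /\ forall x, r x <= p x.
  by split=> // x; exact: le_trans (rq x) ((svalP q).2 x).
by rewrite -(qmax (exist _ r rp)) //; apply/asboolP.
Qed.

(** Lowering [q] by the cone spanned by [(- y, - q y)] gives a sublinear
    functional below [q], hence [q] itself. This says that
    [q x <= q (x + y) - q y], the converse of subadditivity. *)
Lemma minimal_sublinear_linear (q : V -> R) : sublinear q ->
  (forall r, sublinear r -> (forall x, r x <= q x) -> r = q) ->
  linear (q : V -> R^o).
Proof.
move=> qs qmin.
have q0 := sublinear0 qs.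
have qD x y : q (x + y) = q x + q y.
  pose C := [set z : V * R | exists2 t, 0 <= t & z = (- (t *: y), - (t * q y))].
  have CC : convex_cone C.
    split=> [|_ _ [s s0 ->] [t t0 ->]|a _ a0 [t t0 ->]] /=.
    - by exists 0 => //; rewrite scale0r mul0r !oppr0.
    - by exists (s + t); rewrite ?addr_ge0// scalerDl mulrDl !opprD.
    - by exists (a * t); rewrite ?mulr_ge0// scalerN mulrN scalerA mulrA.
  have Cq z : C z -> - q (- z.1) <= z.2.
    by move=> [t t0 ->] /=; rewrite opprK lerN2 (sublinearZ _ qs).
  have e := qmin _ (lower_by_sublinear qs CC Cq) (lower_by_dom qs CC Cq).
  have : C (- y, - q y) by exists 1; rewrite ?scale1r ?mul1r.
  move=> /(lower_by_le qs CC Cq x); rewrite e /= opprK => qle.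
  by apply/eqP; rewrite eq_le qs.1 /=; lra.
have qN x : q (- x) = - q x.
  by apply/eqP; rewrite -addr_eq0 -qD addNr q0.
move=> a x y; rewrite qD; congr (_ + _).
have [a0|a0] := leP 0 a; first exact: sublinearZ.
have na0 : 0 <= - a by rewrite oppr_ge0 ltW.
by have := sublinearZ x qs na0; rewrite scaleNr qN mulNr => /oppr_inj.
Qed.

(** A minimal sublinear functional below [lower_by p C] is linear. This form
    serves both for extension of a functional, the cone being its graph, and for
    separation from a closed subspace. *)
Theorem mazur_orlicz (p : V -> R) (C : set (V * R)) :
  sublinear p -> convex_cone C -> (forall z, C z -> - p (- z.1) <= z.2) ->
  exists F : {linear V -> R^o},
    (forall x, F x <= p x) /\ (forall z, C z -> F z.1 <= z.2).
Proof.
move=> ps CC Cp.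
have [q [qs qp qmin]] := minimal_sublinear (lower_by_sublinear ps CC Cp).
have ql := minimal_sublinear_linear qs qmin.
pose F : {linear V -> R^o} :=
  HB.pack (q : V -> R^o) (GRing.isLinear.Build R V R^o *:%R q ql).
exists F; split=> [x|z Cz].
  exact: le_trans (qp x) (lower_by_dom ps CC Cp x).
exact: le_trans (qp z.1) (lower_by_cone ps CC Cp Cz).
Qed.

End Mazur_Orlicz.

(** * Ultrafilter limits *)

(** Ultrafilters on [nat] play the role of subsequences: several sequences
    converge along one and the same ultrafilter, in compact spaces that need not
    be sequentially compact. *)
Lemma ultra_limit (I : Type) (T : topologicalType) (F : set_system I)
    (K : set T) (u : I -> T) : UltraFilter F -> compact K ->
  (\forall i \near F, K (u i)) -> exists2 p, K p & u @ F --> p.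
Proof.
move=> FU cK FK.
have [p [Kp Fp]] := cK (u @ F) _ FK.
exists p => // A pA; have [//|FnA] := in_ultra_setVsetC (u @^-1` A) FU.
have [x [nAx Ax]] := Fp (~` A) A FnA pA.
by have := nAx Ax.
Qed.

(** In a compact space it is thus enough to identify the limits along
    ultrafilters. *)
Lemma ultra_above_cvg (I : Type) (T : topologicalType) (F : set_system I)
    (u : I -> T) (x : T) : ProperFilter F ->
  (forall G, UltraFilter G -> F `<=` G -> u @ G --> x) -> u @ F --> x.
Proof.
move=> FF uG A xA; apply: contrapT => nFA.
have PF : ProperFilter (within (u @^-1` (~` A)) F).
  apply: Build_ProperFilter_ex => B FB; apply: contrapT => B0; apply: nFA.
  apply: (@filterS _ F _ _ _ _ FB) => i /= Bi; apply: contrapT => nAi; apply: B0.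
  by exists i; exact: Bi.
have [G [GU sG]] := ultraFilterLemma PF.
have GA : G (u @^-1` A).
  by apply: (uG _ GU) xA => B FB; apply: sG; apply: filterS FB.
have GnA : G (u @^-1` (~` A)) by apply: sG; apply: nearW.
by have [i [? ?]] := filter_ex (filterI GA GnA).
Qed.

Lemma ultra_eventually : exists2 F : set_system nat, UltraFilter F & \oo `<=` F.
Proof. by have [F [? ?]] := ultraFilterLemma (eventually_filter); exists F. Qed.

(** * Bounded operators and functionals *)

Section Bounded_functionals.
Context {R : realType}.

Lemma bounded_op_ext (V W : normedModType R) (f g : bounded_op V W) :
  f =1 g -> f = g.
Proof.
case: f g => [[f [[f1] [f2]]] cf] [[g [[g1] [g2]]] cg] /= /funext fg.
rewrite /= in fg; subst g.
have <- : f1 = g1 by exact: Prop_irrelevance.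
have <- : f2 = g2 by exact: Prop_irrelevance.
by have <- : cf = cg by exact: Prop_irrelevance.
Qed.

Lemma opnorm_le1P (V W : normedModType R) (f : {linear V -> W}) :
  (opnorm f <= 1)%E <-> forall x, `|f x| <= `|x|.
Proof.
split=> [f1 x|fx]; last first.
  by apply: ge_ereal_sup => _ [x /= x1 <-]; rewrite lee_fin (le_trans (fx x)).
have [->|x0] := eqVneq x 0; first by rewrite linear0 normr0.
have nx : 0 < `|x| by rewrite normr_gt0.
have : (`|f (`|x|^-1 *: x)|%:E <= 1)%E.
  apply: le_trans f1; apply: ereal_sup_ubound; exists (`|x|^-1 *: x) => //=.
  by rewrite normrZ normfV normr_id mulVf// gt_eqF.
by rewrite lee_fin linearZ normrZ normfV normr_id ler_pdivrMl// mulr1.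
Qed.

Lemma bounded_op_bound (V W : normedModType R) (f : bounded_op V W) :
  exists2 c : R, 0 < c & forall x, `|f x| <= c * `|x|.
Proof.
have /linear_boundedP [c [_ cP]] :=
  (linear_bounded_continuous f).2 (@bounded_op_continuous _ _ _ f).
exists (Num.max c 0 + 1) => [|x]; last apply: cP.
  by rewrite ltr_wpDl// le_max lexx orbT.
by rewrite ltr_pwDr// le_max lexx.
Qed.

(** The one-sided bound suffices because [F (- x) = - F x]. *)
Lemma bounded_linear_dual (V : normedModType R) (F : {linear V -> R^o}) (c : R) :
  (forall x, F x <= c * `|x|) ->
  exists2 f : dual V, (f : V -> R^o) = F & forall x, `|f x| <= c * `|x|.
Proof.
move=> Fc.
have Fn x : `|F x| <= c * `|x|.
  rewrite ler_norml Fc andbT lerNl -linearN.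
  by apply: le_trans (Fc _) _; rewrite normrN.
have FC : continuous F.
  apply/linear_bounded_continuous/linear_boundedP.
  exists c; split; first exact: num_real.
  by move=> d cd x; apply: le_trans (Fn x) _; rewrite ler_wpM2r// ltW.
by exists (@BoundedOp R V R^o F FC).
Qed.

Lemma sublinear_norm (V : normedModType R) (c : R) : 0 <= c ->
  sublinear (fun x : V => c * `|x|).
Proof.
move=> c0; split=> [x y|a x a0].
  by rewrite -mulrDr ler_wpM2l// ler_normD.
by rewrite normrZ (ger0_norm a0) mulrCA.
Qed.

End Bounded_functionals.

Section Subspaces.
Context {R : realType} {X : completeNormedModType R} (Y : closed_subspace X).

Lemma restrictionE (f : dual X) y : restriction Y f y = f (val y).
Proof. by []. Qed.

Theorem hahn_banach (g : dual (subspace_type Y)) (c : R) : 0 <= c ->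
  (forall y, `|g y| <= c * `|y|) ->
  exists2 f : dual X, restriction Y f = g & forall x, `|f x| <= c * `|x|.
Proof.
move=> c0 gc.
pose C := [set z : X * R | exists y : subspace_type Y, z = (val y, g y)].
have [|||F [Fc FC]] := mazur_orlicz (p := fun x => c * `|x|) (C := C).
- exact: sublinear_norm.
- split=> [|_ _ [y ->] [z ->]|a _ _ [y ->]] /=.
  + by exists 0; rewrite !linear0.
  + by exists (y + z); rewrite !linearD.
  + by exists (a *: y); rewrite !linearZ.
- move=> _ [y ->] /=; rewrite normrN lerNl.
  by apply: le_trans (gc y); rewrite -normrN ler_norm.
have [f fF fc] := bounded_linear_dual Fc.
exists f => //; apply: bounded_op_ext => y; rewrite restrictionE fF.
have Fle z : F (val z) <= g z by apply: (FC (val z, g z)); exists z.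
apply/eqP; rewrite eq_le Fle/=.
by have := Fle (- y); rewrite !linearN lerN2.
Qed.

Theorem hahn_banach_separation (x : X) : ~ carrier Y x ->
  exists f : dual X,
    [/\ forall y, carrier Y y -> f y = 0, f x != 0 & forall z, `|f z| <= `|z|].
Proof.
move=> nYx.
have [e e0 xe] : exists2 e : R, 0 < e & forall y, carrier Y y -> e <= `|x - y|.
  have : nbhs x (~` Y).
    by apply: open_nbhs_nbhs; split => //; rewrite openC; exact: carrier_closed.
  move=> /nbhs_normP[e /= e0 xe]; exists e => // y Yy; rewrite leNgt.
  by apply/negP => /xe.
have Y0 : carrier Y 0 by exact/set_mem/(carrier_linear Y).1.
have YD a y z : carrier Y y -> carrier Y z -> carrier Y (a *: y + z).
  by move=> /mem_set Yy /mem_set Yz; exact/set_mem/(carrier_linear Y).2.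
have YZ a y : carrier Y y -> carrier Y (a *: y).
  by move=> ?; rewrite -[_ *: _]addr0; exact: YD.
(* [t = 0] makes [F] vanish on [Y]; [t = 1] and [y = 0] give [e <= F x]. *)
pose C := [set z : X * R | exists t y,
  [/\ 0 <= t, carrier Y y & z = (y - t *: x, - (t * e))]].
have [|||F [Fc FC]] := mazur_orlicz (p := fun x => 1 * `|x|) (C := C).
- exact: sublinear_norm.
- split=> [|_ _ [s [y [s0 Yy ->]]] [t [z [t0 Yz ->]]]|a _ a0 [t [y [t0 Yy ->]]]].
  + by exists 0, 0; rewrite scale0r subr0 mul0r oppr0.
  + exists (s + t), (y + z); split; first exact: addr_ge0.
      by rewrite -[y]scale1r; exact: YD.
    by rewrite /= scalerDl mulrDl !opprD addrACA.
  + exists (a * t), (a *: y); split; [exact: mulr_ge0|exact: YZ|].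
    by rewrite /= scalerBr scalerA mulrN mulrA.
- move=> _ [t [y [t0 Yy ->]]] /=; rewrite mul1r lerN2 opprB.
  have [->|tn0] := eqVneq t 0; first by rewrite mul0r.
  have -> : t *: x - y = t *: (x - t^-1 *: y).
    by rewrite scalerBr scalerA mulfV// scale1r.
  by rewrite normrZ (ger0_norm t0) ler_wpM2l//; apply/xe/YZ.
have [f fF fc] := bounded_linear_dual Fc.
have Yf y : carrier Y y -> f y <= 0.
  move=> Yy; rewrite fF; apply: (FC (y, 0)).
  by exists 0, y; rewrite scale0r mul0r subr0 oppr0.
exists f; split=> [y Yy||z]; last by rewrite -[`|z|]mul1r.
  apply/eqP; rewrite eq_le Yf//= -oppr_le0 -linearN Yf//.
  by rewrite -scaleN1r; exact: YZ.
have : F (- x) <= - e.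
  by apply: (FC (- x, - e)); exists 1, 0; rewrite scale1r mul1r sub0r.
rewrite -fF linearN lerN2 => efx.
by rewrite gt_eqF// (lt_le_trans e0).
Qed.

End Subspaces.

(** * The weak* topology *)

Section Weak_star.
Context {R : realType} (V : normedModType R).

Lemma dual_linear (f : dual V) (a : R) x y : f (a *: x + y) = a * f x + f y.
Proof. exact: linearP. Qed.

Lemma dualZ (f : dual V) (a : R) x : f (a *: x) = a * f x.
Proof. exact: linearZ. Qed.

Lemma dual_cvgP (F : set_system (dual V)) (f : dual V) {FF : Filter F} :
  (F --> f) <-> (forall x, (fun g : dual V => g x : R) @ F --> (f x : R)).
Proof.
split=> [Ff x|Ff].
  have : @dual_fun R V @ F --> dual_fun f.
    have K := @initial_continuous _ _ (@dual_fun R V) f.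
    exact: cvg_comp _ _ Ff K.
  by move=> /pointwise_cvgP; apply.
move=> A; rewrite /nbhs /= => -[_ [[B oB <-] Bf] BA].
have : @dual_fun R V @ F --> dual_fun f by apply/pointwise_cvgP.
move=> /(_ B) FB; apply: filterS BA _; apply: FB.
exact: open_nbhs_nbhs.
Qed.

Lemma dual_eval_continuous (x : V) : continuous (fun f : dual V => f x : R).
Proof. by move=> f; exact: (@dual_cvgP (nbhs f) f _).1. Qed.

Lemma dual_hausdorff : hausdorff_space (dual V).
Proof.
move=> f g; rewrite cluster_cvgE => -[G PG [Gg fG]].
apply: bounded_op_ext => x.
have FG : Filter G by exact: _.
have fx := (@dual_cvgP G f FG).1 fG x; have gx := (@dual_cvgP G g FG).1 Gg x.
exact: (cvg_unique (@norm_hausdorff R R^o) fx gx).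
Qed.

Lemma dual_ballP (f : dual V) : dual_ball V f <-> forall x, `|f x| <= `|x|.
Proof. exact: opnorm_le1P. Qed.

(** Along an ultrafilter the functionals converge pointwise, by compactness of
    segments, and the pointwise limit is linear with the same bound. *)
Theorem banach_alaoglu : compact (dual_ball V).
Proof.
rewrite compact_ultra => F FU FB.
have FF : Filter F by exact: _.
have /choice[l lP] (x : V) : exists l : R, `|l| <= `|x| /\
      (fun f : dual V => f x : R) @ F --> l.
  have [|l] := ultra_limit (u := fun f : dual V => f x : R) FU
      (segment_compact (a := - `|x|) (b := `|x|)).
    by apply: filterS FB => f /dual_ballP /(_ x); rewrite /= in_itv /= -ler_norml.
  by rewrite /= in_itv /= -ler_norml; exists l.
have hR := @norm_hausdorff R R^o.
have ll : linear (l : V -> R^o).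
  move=> a x y; apply: (cvg_unique hR (lP _).2).
  have /funext -> : (fun f : dual V => f (a *: x + y) : R) =1
                    (fun f : dual V => a * f x + f y).
    by move=> f; rewrite linearP.
  by apply: cvgD; [apply: cvgM; [exact: cvg_cst|exact: (lP x).2]|exact: (lP y).2].
pose L : {linear V -> R^o} :=
  HB.pack (l : V -> R^o) (GRing.isLinear.Build R V R^o *:%R l ll).
have [x|f fL f1] := @bounded_linear_dual R V L 1.
  by rewrite mul1r (le_trans (ler_norm _))//; exact: (lP x).1.
exists f; split; first by apply/dual_ballP => x; rewrite -[`|x|]mul1r.
apply/dual_cvgP => x; rewrite fL; exact: (lP x).2.
Qed.

End Weak_star.

(** * Subsets as topological spaces *)

Section Subsets.
Context {T : topologicalType} (A : set T).

Lemma set_val_continuous : continuous (set_val : A -> T).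
Proof. exact: initial_continuous. Qed.

Lemma set_type_nbhs (x : A) (U : set A) :
  nbhs x U <-> exists2 V, nbhs (set_val x) V & set_val @^-1` V `<=` U.
Proof.
split=> [|[V xV VU]]; last by apply: (filterS VU); exact: (@set_val_continuous x V).
rewrite /nbhs /= => -[_ [[V oV <-] Vx] VU]; exists V => //.
exact: open_nbhs_nbhs.
Qed.

Lemma set_type_cvg (I : Type) (F : set_system I) (u : I -> A) (x : A) :
  Filter F -> (set_val \o u) @ F --> set_val x -> u @ F --> x.
Proof.
move=> FF ux U /set_type_nbhs[V xV VU].
apply: (@filterS _ F _ _ _ _ (ux V xV)) => i; exact: VU.
Qed.

Lemma set_type_continuous (S : topologicalType) (f : S -> A) :
  continuous (set_val \o f) -> continuous f.
Proof. by move=> cf x; apply: set_type_cvg; exact: cf. Qed.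

Lemma set_type_compact : compact A -> compact [set: A].
Proof.
move=> cA; rewrite compact_ultra => F FU _.
have [|p Ap Fp] := ultra_limit (u := set_val) FU cA.
  by apply: nearW => x; exact/set_mem/valP.
have Ap' := mem_set Ap.
by exists (exist _ p Ap'); split => //; exact: (@set_type_cvg _ F id).
Qed.

Lemma set_type_hausdorff : hausdorff_space T -> hausdorff_space A.
Proof.
move=> hT x y xy; apply/val_inj/hT => U V xU yV.
have [z [? ?]] := xy _ _ (@set_val_continuous x U xU) (@set_val_continuous y V yV).
by exists (set_val z).
Qed.

End Subsets.

Lemma metrizable_first_countable (R : realType) (T : topologicalType) (x : T) :
  metrizable R T -> exists B : nat -> set T, (forall n, nbhs x (B n)) /\
    forall A, nbhs x A -> exists N, forall n, (N <= n)%N -> B n `<=` A.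
Proof.
move=> [d [_ _ _ dP]]; exists (fun n => [set y | d x y < n.+1%:R^-1]); split.
  by move=> n; apply/dP; exists n.+1%:R^-1.
move=> A /dP[e e0 eA].
have [N _ NP] := near_infty_natSinv_lt (PosNum e0).
exists N => n Nn y /= dy; apply: eA; apply: lt_trans dy _; exact: NP.
Qed.

(** * Directed sigma-complete posets *)

Section Directed.
Context {disp : Order.disp_t} {G : porderType disp}.
Local Open Scope order_scope.
Hypothesis Gdir : up_directed G.
Hypothesis Gsig : sigma_complete G.

Definition ascending (s : nat -> G) : Prop := forall n, s n <= s n.+1.

Lemma ascending_le (s : nat -> G) m n :
  ascending s -> (m <= n)%N -> s m <= s n.
Proof.
move=> si; elim: n => [|n IH]; first by rewrite leqn0 => /eqP ->.
rewrite leq_eqVlt => /orP[/eqP -> //|]; rewrite ltnS => /IH h.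
exact: le_trans h (si n).
Qed.

Lemma countable_upper_bound (s : nat -> G) : exists t, forall n, s n <= t.
Proof.
have /choice[u uP] (p : G * G) : exists u, p.1 <= u /\ p.2 <= u by exact: Gdir.
pose b := fix b n := if n is m.+1 then u (b m, s m.+1) else s 0%N.
have bi : ascending b by move=> n /=; exact: (uP (b n, s n.+1)).1.
have [t [bt _]] := Gsig bi; exists t => -[|n]; first exact: (bt 0%N).
by apply: le_trans (bt n.+1); exact: (uP (b n, s n.+1)).2.
Qed.

Lemma tails_filter (s0 : G) : ProperFilter (tails G).
Proof.
apply: filter_from_proper; last by move=> t _; exists t => /=.
apply: filter_from_filter; first by exists s0.
move=> t u _ _; have [v [tv uv]] := Gdir t u; exists v => // w /= vw.
by split; [exact: le_trans vw|exact: le_trans vw].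
Qed.

(** The continuity axioms of skeletons only concern strictly increasing
    sequences; constructions by recursion produce sequences that may be
    stationary, and this lemma bridges the two. *)
Lemma ascending_dichotomy (s : nat -> G) (t : G) :
  ascending s -> is_supremum s t ->
  (exists N, s N = t) \/
  (exists phi : nat -> nat, [/\ forall n, (n <= phi n)%N,
     strictly_increasing (s \o phi) & is_supremum (s \o phi) t]).
Proof.
move=> si [st tmin].
have [[N NP]|noN] := pselect (exists N, forall n, (N <= n)%N -> s n = s N).
  left; exists N; apply/eqP; rewrite eq_le st/=; apply: tmin => n.
  have [nN|/ltnW/NP -> //] := leqP n N; exact: ascending_le.
right; have /choice[f fP] N : exists n, (N < n)%N && (s N < s n).
  apply: contrapT => Nn; apply: noN; exists N => n Nlen.
  apply/eqP/negPn/negP => nN; apply: Nn; exists n.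
  have lt : s N < s n by rewrite lt_neqAle eq_sym nN ascending_le.
  rewrite lt andbT ltn_neqAle Nlen andbT; apply: contraNneq nN => <-.
  exact: eqxx.
pose phi n := iter n f 0%N.
have phin n : (n <= phi n)%N.
  elim: n => // n IH; rewrite /phi iterS; apply: leq_ltn_trans IH _.
  by case/andP: (fP (phi n)).
exists phi; split=> //.
  by move=> n; have /andP[] := fP (phi n).
split=> [n|u su]; first exact: st.
apply: tmin => n; apply: le_trans (su n); exact: ascending_le.
Qed.

End Directed.

(** * Retractional skeletons *)

Section Retractional.
Context {R : realType} {K : topologicalType}.
Hypothesis cK : compact [set: K].
Hypothesis hK : hausdorff_space K.
Context {disp : Order.disp_t} {G : porderType disp} (r : G -> K -> K).
Hypothesis rs : retractional_skeleton (R := R) r.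
Let S := induced_by_retractions r.

Lemma rs_fixed s t x : (s <= t)%O -> r s x = x -> r t x = x.
Proof.
by move=> st rx; have [_] := rs_commute rs st x; rewrite rx => <-.
Qed.

(** A form of continuity that can be checked along a cofinal subsequence, and so
    holds for sequences that are only nondecreasing. *)
Lemma rs_sup_eq (s : nat -> G) (t : G) x y :
  ascending s -> is_supremum s t -> (forall n, r (s n) x = r (s n) y) ->
  r t x = r t y.
Proof.
move=> si st xy.
have [[N <-]//|[phi [_ sphi tphi]]] := ascending_dichotomy si st.
have ty := @rs_continuous _ _ _ _ _ rs _ _ sphi tphi y.
have tx := @rs_continuous _ _ _ _ _ rs _ _ sphi tphi x.
apply: (cvg_unique hK tx); rewrite /= in ty *.
by under eq_fun do rewrite xy.
Qed.

Lemma rs_sup_fixed_eq (s : nat -> G) (t : G) x y :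
  ascending s -> is_supremum s t -> r t x = x -> r t y = y ->
  (forall n, r (s n) x = r (s n) y) -> x = y.
Proof. by move=> si st tx ty xy; rewrite -tx -ty; exact: rs_sup_eq xy. Qed.

Lemma rs_limit_fixed (F : set_system nat) (t : G) (u : nat -> K) (x : K) :
  ProperFilter F -> (forall n, r t (u n) = u n) -> u @ F --> x -> r t x = x.
Proof.
move=> FF ut ux.
have := cvg_comp _ _ ux (@rs_continuous_map _ _ _ _ _ rs t x).
have -> : r t \o u = u by apply/funext => n /=.
by move=> h; exact: cvg_unique h ux.
Qed.

Lemma induced_fixed x : S x -> exists s, r s x = x.
Proof. by move=> [s _ [y _ <-]]; exists s; rewrite (rs_retraction rs). Qed.

Lemma induced_dense : dense S.
Proof.
move=> O [x Ox] oO; have [|s _ sO] := @rs_limit _ _ _ _ _ rs x O.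
  exact: open_nbhs_nbhs.
 exists (r s x); split; last by exists s.
by apply: sO => /=.
Qed.

(** Preimages of a countable base at [r s x] in the metrizable range of
    [r s]. *)
Lemma rs_neighbourhoods (s : G) (x : K) : exists U : nat -> set K,
  (forall n, nbhs x (U n)) /\
  forall A, nbhs (r s x) A ->
    exists N, forall n, (N <= n)%N -> U n `<=` r s @^-1` A.
Proof.
have cr : continuous (corestrict (r s)).
  by apply: set_type_continuous; exact: (rs_continuous_map rs).
have [B [xB BA]] := metrizable_first_countable (corestrict (r s) x)
  (rs_metrizable rs s).
exists (fun n => corestrict (r s) @^-1` B n); split=> [n|A xA]; first exact: cr.
have [|N NP] := BA (set_val @^-1` A); first exact: set_val_continuous.
by exists N => n Nn y /= /(NP _ Nn).
Qed.

(** The sequences [s] and [b] are built together: [b n] is a point of [A] whose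
    image under [r (s k)] is close to that of [x] for all [k <= n], and
    [s n.+1] is large enough to fix [b n]. A cluster point of [b] is fixed by
    the retraction at the supremum and agrees with [x] under every [r (s k)], so
    it is [x]. *)
Theorem induced_frechet_urysohn (A : set K) (x : K) :
  A `<=` S -> S x -> closure A x ->
  exists2 a : nat -> K, (forall n, A (a n)) & a @ \oo --> x.
Proof.
move=> AS Sx Ax; have [s0 s0x] := induced_fixed Sx.
have /choice[u uP] (p : G * G) : exists u, (p.1 <= u)%O /\ (p.2 <= u)%O.
  exact: (rs_directed rs).
have /choice[sg sgP] y : exists s, S y -> r s y = y.
  by have [/induced_fixed[s ?]|] := pselect (S y); [exists s|exists s0].
have /choice[U UP] s := rs_neighbourhoods s x.
have /choice[a aP] W : exists y, nbhs x W -> A y /\ W y.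
  by have [/Ax[y ?]|] := pselect (nbhs x W); [exists y|exists x].
(* [W n m] is the intersection of the [U (s k) m] for [k <= n]; carrying it as
   part of the state spares a recursion on the whole history. *)
pose step (p : G * (nat -> set K)) n :=
  let v := u (p.1, sg (a (p.2 n))) in (v, fun m => p.2 m `&` U v m).
pose st := fix st n := if n is m.+1 then step (st m) m else (s0, U s0).
pose s n := (st n).1; pose W n := (st n).2; pose b n := a (W n n).
have Wx n m : nbhs x (W n m).
  elim: n => [|n IH]; first exact: (UP _).1.
  by apply: filterI; [exact: IH|exact: (UP _).1].
have WU n k m : (k <= n)%N -> W n m `<=` U (s k) m.
  elim: n => [|n IH]; first by rewrite leqn0 => /eqP ->.
  rewrite leq_eqVlt => /orP[/eqP -> y []//|]; rewrite ltnS => /IH kn y [].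
  by move=> + _; exact: kn.
have Ab n : A (b n) by exact: (aP _ (Wx n n)).1.
have si : ascending s by move=> n; exact: (uP (_, _)).1.
have [t st_t] := rs_sigma_complete rs si; have [st_le _] := st_t.
have tb n : r t (b n) = b n.
  apply: (rs_fixed (st_le n.+1)); apply: rs_fixed (uP (_, _)).2 _.
  by apply: sgP; apply: AS; exact: Ab.
exists b => //; apply: ultra_above_cvg => F FU oF.
have [p _ bp] := ultra_limit (u := b) FU cK (nearW _ (fun=> I)).
suff <- : p = x by [].
apply: (rs_sup_fixed_eq si st_t).
- exact: rs_limit_fixed tb bp.
- exact: rs_fixed (st_le 0%N) s0x.
move=> k; have rp := cvg_comp _ _ bp (@rs_continuous_map _ _ _ _ _ rs (s k) p).
apply: (cvg_unique hK rp) => A' xA'; apply: oF.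
have [N NP] := (UP (s k)).2 _ xA'.
exists (maxn N k) => // n /=; rewrite geq_max => /andP[Nn kn].
apply: (NP _ Nn); apply: (WU _ _ _ kn); exact: (aP _ (Wx n n)).2.
Qed.

Definition retract (s : G) (x : K) : S :=
  exist _ (r s x) (mem_set (ex_intro2 _ _ s I (imageT (r s) x))).

Lemma retract_continuous s : continuous (retract s).
Proof. by apply: set_type_continuous; exact: (rs_continuous_map rs). Qed.

(** Otherwise there are indices [s n], increasing, and points [p n] fixed by
    [r (s n.+1)], such that the values of [phi] at [p n] and at its image [q n]
    under some [r u], with [u] between [s n] and [s n.+1], differ by more than
    [e]. The limits of [p] and [q] along an ultrafilter are fixed by the
    retraction at the supremum and agree under every [r (s k)]. They are thus
    equal, which contradicts the continuity of [phi]. *)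
Lemma induced_uniform_approximation (phi : S -> R) (e : R) (x0 : K) :
  continuous phi -> 0 < e ->
  exists s, forall t, (s <= t)%O ->
    forall p : S, `|phi p - phi (retract t (set_val p))| <= e.
Proof.
move=> cphi e0; apply: contrapT => nos.
have [s0 _ _] := @rs_limit _ _ _ _ _ rs x0 _ filterT.
have /choice[f fP] s : exists p : G * S, (s <= p.1)%O /\
    e < `|phi p.2 - phi (retract p.1 (set_val p.2))|.
  apply: contrapT => nop; apply: nos; exists s => t st p; rewrite leNgt.
  by apply/negP => ep; apply: nop; exists (t, p).
have /choice[u uP] (p : G * G) : exists u, (p.1 <= u)%O /\ (p.2 <= u)%O.
  exact: (rs_directed rs).
have /choice[sg sgP] (p : S) : exists s, r s (set_val p) = set_val p.
  by apply: induced_fixed; exact/set_mem/valP.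
pose s n := iter n (fun v => u ((f v).1, sg (f v).2)) s0.
have s1 n : ((f (s n)).1 <= s n.+1)%O by exact: (uP (_, _)).1.
have si : ascending s by move=> n; exact: le_trans (fP _).1 (s1 n).
have [t st] := rs_sigma_complete rs si; have [s_le _] := st.
pose p n := set_val (f (s n)).2; pose q n := r (f (s n)).1 (p n).
have tp n : r t (p n) = p n.
  apply: (rs_fixed (s_le n.+1)); apply: rs_fixed (uP (_, _)).2 _; exact: sgP.
have tq n : r t (q n) = q n.
  apply: (rs_fixed (s_le n.+1)); apply: (rs_fixed (s1 n)).
  exact: (rs_retraction rs).
have [F FU oF] := ultra_eventually.
have [y _ py] := ultra_limit (u := p) FU cK (nearW _ (fun=> I)).
have [z _ qz] := ultra_limit (u := q) FU cK (nearW _ (fun=> I)).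
have PF : ProperFilter F by exact: _.
have ty := rs_limit_fixed PF tp py; have tz := rs_limit_fixed PF tq qz.
have yz : z = y.
  apply: (rs_sup_fixed_eq si st) => // k.
  have ry := cvg_comp _ _ py (@rs_continuous_map _ _ _ _ _ rs (s k) y).
  have rz := cvg_comp _ _ qz (@rs_continuous_map _ _ _ _ _ rs (s k) z).
  apply: (cvg_unique hK rz) => A /ry FA.
  have Fk : F [set n | (k <= n)%N] by apply: oF; exists k.
  apply: (@filterS2 _ F _ _ _ _ _ Fk FA) => n /= kn Ap; rewrite /q.
  have kf : (s k <= (f (s n)).1)%O.
    exact: le_trans (ascending_le si kn) (fP _).1.
  by rewrite -(rs_commute rs kf _).1.
have Sy : S y by exists t => //; exists y.
pose y' : S := exist _ y (mem_set Sy).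
have py' : (fun n => (f (s n)).2) @ F --> y' by apply: set_type_cvg; exact: py.
have qy' : (fun n => retract (f (s n)).1 (p n)) @ F --> y'.
  by apply: set_type_cvg; rewrite (_ : set_val y' = z); [exact: qz|exact/esym].
have phip := cvg_comp _ _ py' (cphi y').
have phiq := cvg_comp _ _ qy' (cphi y').
have d0 : (phi (f (s n)).2 - phi (retract (f (s n)).1 (p n))) @[n --> F] --> 0.
  by rewrite -(subrr (phi y')); exact: cvgB phip phiq.
have [n /=] := filter_ex ((cvgrPdist_lt _ _).1 d0 e e0).
rewrite sub0r normrN => ne.
by have := lt_trans (fP (s n)).2 ne; rewrite ltxx.
Qed.

(** One index serves for the errors [1 / (n + 1)] for all [n]. *)
Lemma induced_factorization (phi : S -> R) (x0 : K) : continuous phi ->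
  exists s, forall p : S, phi (retract s (set_val p)) = phi p.
Proof.
move=> cphi.
have /choice[s sP] (n : nat) : exists s, forall t, (s <= t)%O ->
    forall p : S, `|phi p - phi (retract t (set_val p))| <= n.+1%:R^-1.
  exact: induced_uniform_approximation.
have [t st] := countable_upper_bound (rs_directed rs) (rs_sigma_complete rs) s.
exists t => p; apply/eqP; rewrite eq_sym -subr_eq0 -normr_le0.
apply/ler_addgt0Pr => e e0; rewrite add0r.
have [n _ /(_ _ (leqnn n)) ne] := near_infty_natSinv_lt (PosNum e0).
exact: le_trans (sP _ _ (st n) p) (ltW ne).
Qed.

End Retractional.

(** * Extension of continuous maps *)

Section Compact_Hausdorff.
Context {R : realType} {C : topologicalType}.
Hypothesis cC : compact [set: C].
Hypothesis hC : hausdorff_space C.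

Lemma compact_hausdorff_separator (c : C) (A : set C) : nbhs c A ->
  exists h : C -> R, [/\ continuous h, h c = 0 & forall z, ~ A z -> h z = 1].
Proof.
move=> cA.
have creg : completely_regular_space C.
  apply: (@normal_completely_regular R); first exact: compact_normal.
  exact: hausdorff_accessible.
have [|h [ch _ h0 h1]] := (@uniform_separatorP C R [set c] (~` A^°)).1.
  apply: creg; first by apply: open_closedC; exact: open_interior.
  by apply.
exists h; split=> // [|z nAz]; first by apply: h0; exists c.
apply: h1; exists z => // Az; apply: nAz; exact: interior_subset Az.
Qed.

(** A Urysohn function turns a neighbourhood in [C] into an inequality. *)
Lemma compact_hausdorff_continuous (T : topologicalType) (g : T -> C) :
  (forall h : C -> R, continuous h -> continuous (h \o g)) -> continuous g.
Proof.
move=> hg x A gA; have [h [ch h0 h1]] := compact_hausdorff_separator gA.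
have : \forall y \near x, (h \o g) y < 1.
  by apply: (cvgr_lt _ (hg h ch x)); rewrite /= h0.
apply: filterS => y; apply: contraTP => /h1 /= ->; by rewrite ltxx.
Qed.

Lemma compact_hausdorff_points (c c' : C) :
  (forall h : C -> R, continuous h -> h c = h c') -> c = c'.
Proof.
move=> e; apply: hC => A B cA c'B; apply: contrapT => AB.
have [h [ch h0 h1]] := compact_hausdorff_separator cA.
have nAc' : ~ A c'.
  by move=> Ac'; apply: AB; exists c'; split => //; exact: nbhs_singleton.
have := h1 c' nAc'; rewrite -(e h ch) h0 => /eqP; by rewrite eq_sym oner_eq0.
Qed.

End Compact_Hausdorff.

(** For each real [h], the function [h \o f] factors through a retraction
    [r (s h)], so [h (f (r t x))] does not depend on [t >= s h]. The extension
    takes at [x] the point [c] for which [h c] is this common value for all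
    [h]: a cluster point of the net [f (r t x)]. It is unique, and depends
    continuously on [x], because real functions determine the topology of [C]. *)
Theorem induced_stone_cech (R : realType) (K : topologicalType)
    (disp : Order.disp_t) (G : porderType disp) (r : G -> K -> K) (x0 : K) :
  compact [set: K] -> hausdorff_space K ->
  retractional_skeleton (R := R) r -> stone_cech (induced_by_retractions r).
Proof.
move=> cK hK rs; split=> //; first exact: induced_dense rs.
move=> C f cC hC cf; set S := induced_by_retractions r in f cf *.
have /choice[s sP] (h : C -> R) : exists s, continuous h ->
    forall p : S, h (f (retract r s (set_val p))) = h (f p).
  have [ch|nch] := pselect (continuous h); last first.
    by have [s _ _] := @rs_limit _ _ _ _ _ rs x0 _ filterT; exists s.
  have chf : continuous (h \o f).
    by move=> p; apply: continuous_comp; [exact: cf|exact: ch].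
  by have [s sP] := induced_factorization cK hK rs x0 chf; exists s.
have /choice[g gP] x : exists c, forall h : C -> R, continuous h ->
    h c = h (f (retract r (s h) x)).
  have [s0 _ _] := @rs_limit _ _ _ _ _ rs x0 _ filterT.
  have PF := tails_filter (rs_directed rs) s0.
  have [F [FU tF]] := ultraFilterLemma PF.
  have [c _ fc] := ultra_limit (u := fun t => f (retract r t x)) FU cC
    (nearW _ (fun=> I)).
  exists c => h ch; have hfc := cvg_comp _ _ fc (ch c).
  apply: (cvg_unique (@norm_hausdorff R R^o) hfc).
  apply: cvg_near_cst.
  have : F [set t | (s h <= t)%O] by apply: tF; exists (s h).
  apply: (@filterS _ F) => t /= st.
  rewrite -(sP h ch (retract r t x)) /=; congr (h (f _)); apply: val_inj => /=.
  by rewrite -(rs_commute rs st x).1.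
exists g => [|p].
  apply: (compact_hausdorff_continuous (R := R) cC hC) => h ch x.
  have -> : h \o g = (h \o f) \o retract r (s h).
    by apply/funext => y /=; exact: gP.
  apply: continuous_comp; first exact: (retract_continuous rs).
  by apply: continuous_comp; [exact: cf|exact: ch].
apply: (compact_hausdorff_points (R := R) cC hC) => h ch.
by rewrite gP// sP.
Qed.


(** * Quotient maps and metrizability *)

(** Let the preimage of [U] be open and let a sequence outside [U] converge to
    [y]. It lifts to a sequence outside the preimage, and so does its limit: a
    cluster point of the lift is outside the preimage and is mapped to [y]. *)
Lemma frechet_urysohn_quotient (S T : topologicalType) (g : S -> T) :
  continuous g -> hausdorff_space T -> frechet_urysohn (set_type (range g)) ->
  (forall (F : set_system nat) (u : nat -> S), UltraFilter F ->
     exists x : S, u @ F --> x) ->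
  quotient_onto_image g.
Proof.
move=> cg hT fuT cS.
have cg' : continuous (corestrict g) by exact: set_type_continuous.
have g'_surj y : exists x, corestrict g x = y.
  by have [x _ gx] := set_mem (valP y); exists x; exact: val_inj.
split.
  by rewrite -subTset => y _; have [x <-] := g'_surj y; exists x.
move=> U; split; first by move=> oU; exact: open_comp.
move=> opU; rewrite -[U]setCK openC => y /fuT[w nUw wy].
have /choice[v vw] n : exists x, corestrict g x = w n by exact: g'_surj.
have [F FU oF] := ultra_eventually.
have [z vz] := cS F v FU.
have gz : corestrict g z = y.
  apply: (cvg_unique (@set_type_hausdorff _ _ hT)) (cvg_comp _ _ vz (cg' z)) _.
  have -> : corestrict g \o v = w by apply/funext => n /=.
  exact: cvg_trans (cvg_app w oF) wy.
move=> Uy; have zU : nbhs z (corestrict g @^-1` U).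
  by apply: open_nbhs_nbhs; split => //=; rewrite gz.
have Fv : F (v @^-1` (corestrict g @^-1` U)) := vz _ zU.
have [n Un] := filter_ex Fv; apply: (nUw n).
by rewrite -(vw n); exact: Un.
Qed.

(** The metric is the supremum of the [`|h n x - h n y|]. The bounds on [h]
    leave finitely many terms to control for the continuity of this metric, and
    a continuous metric on a compact space induces its topology. *)
Lemma compact_metrizable (R : realType) (T : topologicalType) (h : nat -> T -> R) :
  compact [set: T] -> (forall n, continuous (h n)) ->
  (forall n x, `|h n x| <= n.+1%:R^-1) ->
  (forall x y, (forall n, h n x = h n y) -> x = y) -> metrizable R T.
Proof.
move=> cT ch hb hsep.
pose d x y := sup [set `|h n x - h n y| | n in [set: nat]].
have le_d x y n : `|h n x - h n y| <= d x y.
  apply: ub_le_sup; last by exists n.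
  exists 2 => _ [k _ <-]; apply: le_trans (ler_normB _ _) _.
  have k1 : k.+1%:R^-1 <= 1 :> R by rewrite invf_le1 ?ltr0n// ler1n.
  move: (hb k x) (hb k y) k1; set v := _^-1; lra.
have d_le x y e : (forall n, `|h n x - h n y| <= e) -> d x y <= e.
  move=> he; apply: ge_sup; first by exists `|h 0%N x - h 0%N y|, 0%N.
  by move=> _ [n _ <-].
exists d; split=> [x y|x y|x y z|x A].
- split=> [dxy|->].
    apply: hsep => n; apply/eqP; rewrite -subr_eq0 -normr_le0.
    by rewrite -dxy.
  apply/eqP; rewrite eq_le d_le => [/=|n]; last by rewrite subrr normr0.
  exact: le_trans (normr_ge0 _) (le_d y y 0%N).
- congr (sup _); apply: eq_imagel => n _; exact: distrC.
- apply: d_le => n; apply: le_trans (ler_distD (h n y) _ _) _.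
  exact: lerD.
split=> [xA|[e e0 eA]]; last first.
  apply: (filterS eA).
  have [N _ /(_ _ (leqnn N)) Ne] := near_infty_natSinv_lt
    (PosNum (divr_gt0 e0 (ltr0n R 4))).
  have : \forall y \near x, forall i : 'I_N, `|h i x - h i y| < e / 2.
    apply: filter_forall => i; apply: (cvgrPdist_lt _ _).1 (ch i x) _ _.
    by rewrite divr_gt0.
  apply: filterS => y hy /=; apply: (@le_lt_trans _ _ (e / 2)); last by lra.
  apply: d_le => n; have [nN|Nn] := ltnP n N; first exact/ltW/(hy (Ordinal nN)).
  apply: le_trans (ler_normB _ _) _.
  have nN : n.+1%:R^-1 <= N.+1%:R^-1 :> R.
    by rewrite lef_pV2 ?posrE ?ltr0n// ler_nat.
  move: (hb n x) (hb n y) nN Ne => /=.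
  by set v := n.+1%:R^-1; set w := N.+1%:R^-1; lra.
apply: contrapT => nA.
have /choice[y yP] n : exists y, d x y < n.+1%:R^-1 /\ ~ A y.
  apply: contrapT => ny; apply: nA; exists n.+1%:R^-1 => // y dy.
  by apply: contrapT => nAy; apply: ny; exists y.
have [F FU oF] := ultra_eventually.
have [z _ yz] := ultra_limit (u := y) FU cT (nearW _ (fun=> I)).
have zx : z = x.
  apply: hsep => k; apply/eqP; rewrite -subr_eq0 -normr_le0.
  have hz := cvg_comp _ _ yz (ch k z).
  apply/ler_addgt0Pr => e e0; rewrite add0r.
  have e2 : 0 < e / 2 by rewrite divr_gt0.
  have F1 : F [set n | `|h k z - h k (y n)| < e / 2].
    exact: (cvgrPdist_lt _ _).1 hz _ e2.
  have F2 : F [set n | n.+1%:R^-1 < e / 2].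
    by apply: oF; exact: (near_infty_natSinv_lt (PosNum e2)).
  have [n [/= n1 n2]] := filter_ex (filterI F1 F2).
  apply: le_trans (ler_distD (h k (y n)) _ _) _.
  move: (le_trans (le_d x (y n) k) (ltW (yP n).1)) n1 n2 => /=.
  rewrite (distrC (h k x)); set v := _^-1; lra.
have Fy : F (y @^-1` A) by apply: (yz A); rewrite zx.
by have [n] := filter_ex Fy; exact: (yP n).2.
Qed.

(** * Separable sets of vectors *)

Section Separable_ranges.
Context {R : realType} {V : normedModType R}.

Lemma separable_sequence (A : set V) : A !=set0 -> separable (set_type A) ->
  exists c : nat -> V, (forall n, A (c n)) /\
    forall x e, A x -> 0 < e -> exists n, `|x - c n| < e.
Proof.
move=> [a0 Aa0] [C /countable_injP[f fi] dC].
have /choice[c cP] n : exists z : V, A z /\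
    forall y, C y -> f y = n -> z = set_val y.
  have [[y [Cy fy]]|ny] := pselect (exists y, C y /\ f y = n).
    exists (set_val y); split; first exact/set_mem/valP.
    move=> y' Cy' fy'; congr set_val; apply: fi; rewrite ?inE//.
    by rewrite fy fy'.
  by exists a0; split=> // y Cy fy; exfalso; apply: ny; exists y.
exists c; split=> [n|x e Ax e0]; first exact: (cP n).1.
have Ax' := mem_set Ax; pose x' : set_type A := exist _ x Ax'.
have [||y [/= xy Cy]] := dC (set_val @^-1` ball x e).
- by exists x' => /=; exact: ballxx.
- apply: open_comp; last exact: ball_open.
  by move=> y _; exact: set_val_continuous.
exists (f y); rewrite ((cP (f y)).2 y Cy erefl).
by move: xy; rewrite -ball_normE.
Qed.

(** The points of the sequence need not belong to the image of [A]: each ball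
    around one of them that meets this image is represented by one point of
    [A]. *)
Lemma isometry_sequence_separable (W : normedModType R) (i : W -> V)
    (A : set W) (c : nat -> V) : A !=set0 ->
  (forall x y, `|i x - i y| = `|x - y|) ->
  (forall x e, A x -> 0 < e -> exists n, `|i x - c n| < e) ->
  separable (set_type A).
Proof.
move=> [a0 /mem_set Aa0] iE cA.
have /choice[y yP] (p : nat * nat) : exists y : set_type A,
    forall x : set_type A, `|i (set_val x) - c p.1| < p.2.+1%:R^-1 ->
      `|i (set_val y) - c p.1| < p.2.+1%:R^-1.
  have [[z zc]|nz] := pselect (exists z : set_type A,
    `|i (set_val z) - c p.1| < p.2.+1%:R^-1); first by exists z.
  by exists (exist _ a0 Aa0) => x xc; exfalso; apply: nz; exists x.
exists (y @` [set: nat * nat]).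
  exact: sub_countable (card_image_le _ _) (countableP _).
move=> O [x Ox] oO.
have /set_type_nbhs[U /nbhs_normP[e /= e0 eU] UO] : nbhs x O.
  exact: open_nbhs_nbhs.
have e2 : 0 < e / 2 by rewrite divr_gt0.
have [m _ /(_ _ (leqnn m)) me] := near_infty_natSinv_lt (PosNum e2).
have m0 : 0 < m.+1%:R^-1 :> R by [].
have [n xn] := cA _ _ (set_mem (valP x)) m0.
exists (y (n, m)); split; last by exists (n, m).
apply: UO => /=; apply: eU => /=; rewrite -iE.
have := ler_distD (c n) (i (set_val x)) (i (set_val (y (n, m)))).
have yn := yP (n, m) x xn; rewrite (distrC (c n)); move: yn xn me => /=.
set v := _^-1; lra.
Qed.

End Separable_ranges.

(** * Projectional skeletons *)

Section Projectional.
Context {R : realType} {V : completeNormedModType R}.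

Lemma dual_linear_combination (a : R) (f g : dual V) :
  exists h : dual V, forall x, h x = a * f x + g x.
Proof.
have [c c0 fc] := bounded_op_bound f; have [c' c'0 gc] := bounded_op_bound g.
pose L : {linear V -> R^o} := a \*: f \+ g.
have [|h hL _] := @bounded_linear_dual R V L (`|a| * c + c').
  move=> x; rewrite /= mulrDl -mulrA; apply: lerD.
    apply: le_trans (ler_norm _) _; rewrite normrM ler_wpM2l//.
  exact: le_trans (ler_norm _) (gc x).
by exists h => x; rewrite hL.
Qed.

Context {disp : Order.disp_t} {G : porderType disp} (P : G -> bounded_op V V).
Hypothesis Psk : r_projectional_skeleton 1 P.
Let ps := Psk.1.
Let D := induced_by_projections P.

Lemma ps_contraction s x : `|P s x| <= `|x|.
Proof. by move: x; apply/opnorm_le1P; exact: Psk.2. Qed.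

Lemma ps_index : inhabited G.
Proof.
have : (\bigcup_s range (P s)) 0 by rewrite (ps_cover ps).
by move=> [s _ _].
Qed.

Lemma ps_fixed s t x : (s <= t)%O -> P s x = x -> P t x = x.
Proof.
by move=> st sx; have [_] := ps_commute ps st x; rewrite sx => <-.
Qed.

Lemma ps_fixed_ex x : exists s, P s x = x.
Proof.
have : (\bigcup_s range (P s)) x by rewrite (ps_cover ps).
by move=> [s _ [y _ <-]]; exists s; exact: (ps_projection ps).
Qed.

(** The continuity axiom, for sequences that are only nondecreasing. *)
Lemma ps_sup_approx (s : nat -> G) (t : G) x e :
  ascending s -> is_supremum s t -> 0 < e ->
  exists n y, P (s n) y = y /\ `|P t x - y| < e.
Proof.
move=> si st e0.
have [[N sN]|[phi [_ sphi tphi]]] := ascending_dichotomy si st.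
  exists N, (P t x); rewrite sN subrr normr0; split=> //.
  exact: (ps_projection ps).
have : range (P t) (P t x) by exists x.
rewrite (ps_continuous ps sphi tphi) => /(_ (ball (P t x) e)).
case=> [|_ [[n _ [z _ <-]] /=]]; first exact: nbhsx_ballx.
rewrite -ball_normE /= => xz; exists (phi n), (P (s (phi n)) z); split=> //.
exact: (ps_projection ps).
Qed.

(** [P (s n)] fixes an approximation [y] of [P t x] for large [n], and
    [P (s n) x = P (s n) (P t x)] is as close to [y] as [P t x] is, because
    [P (s n)] is a contraction. *)
Lemma ps_sup_cvg (s : nat -> G) (t : G) x :
  ascending s -> is_supremum s t -> P (s n) x @[n --> \oo] --> P t x.
Proof.
move=> si st; apply/cvgrPdist_lt => e e0.
have e2 : 0 < e / 2 by rewrite divr_gt0.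
have [N [y [Ny xy]]] := ps_sup_approx x si st e2.
exists N => // n /= Nn.
have ny : P (s n) y = y := ps_fixed (ascending_le si Nn) Ny.
rewrite (ps_commute ps (st.1 n) x).1.
have -> : P t x - P (s n) (P t x) = (P t x - y) + P (s n) (y - P t x).
  by rewrite linearB ny addrA subrK.
apply: le_lt_trans (ler_normD _ _) _.
by have := ps_contraction (s n) (y - P t x); rewrite (distrC y); lra.
Qed.

(** An index [s] with the property on the right is said to carry [d] in what
    follows. *)
Lemma induced_dualP (d : dual V) : D d <-> exists s, forall x, d (P s x) = d x.
Proof.
split=> [[s _ [f _ <-]]|[s ds]]; exists s => //.
  by move=> x; rewrite /= (ps_projection ps).
by exists d => //; exact: bounded_op_ext.
Qed.

Lemma ps_support_le (d : dual V) s t : (s <= t)%O ->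
  (forall x, d (P s x) = d x) -> forall x, d (P t x) = d x.
Proof.
by move=> st ds x; rewrite -ds -(ps_commute ps st x).1 ds.
Qed.

Lemma induced_dual_linear (a : R) (f g : dual V) : D f -> D g ->
  exists2 h : dual V, D h & forall x, h x = a * f x + g x.
Proof.
move=> /induced_dualP[s fs] /induced_dualP[t gt].
have [u [su tu]] := ps_directed ps s t.
have [h hE] := dual_linear_combination a f g; exists h => //.
apply/induced_dualP; exists u => x; rewrite !hE.
by rewrite (ps_support_le su fs) (ps_support_le tu gt).
Qed.

(** A single index carries all the terms of a sequence of the induced set, and
    the equation that expresses this passes to pointwise limits. *)
Lemma induced_dual_countably_compact (F : set_system nat) (u : nat -> dual V) :
  UltraFilter F -> (forall n, (D `&` dual_ball V) (u n)) ->
  exists2 d, (D `&` dual_ball V) d & u @ F --> d.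
Proof.
move=> FU Du.
have [|d Bd ud] := ultra_limit (u := u) FU (banach_alaoglu (V := V)).
  by apply: nearW => n; exact: (Du n).2.
exists d => //; split=> //; apply/induced_dualP.
have /choice[s sP] n : exists s, forall x, u n (P s x) = u n x.
  exact/induced_dualP/(Du n).1.
have [t st] := countable_upper_bound (ps_directed ps) (ps_sigma_complete ps) s.
exists t => x.
have h1 := cvg_comp _ _ ud (@dual_eval_continuous _ _ (P t x) d).
have h2 := cvg_comp _ _ ud (@dual_eval_continuous _ _ x d).
apply: (cvg_unique (@norm_hausdorff R R^o) h1).
have /funext -> : (fun f : dual V => f (P t x) : R) \o u =1
    (fun f : dual V => f x : R) \o u.
  by move=> n /=; exact: ps_support_le (st n) (sP n) x.
exact: h2.
Qed.

Lemma adjoint_tails_cvg (f : dual V) : adjoint (P s) f @[s --> tails G] --> f.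
Proof.
have [s0] := ps_index; have PF := tails_filter (ps_directed ps) s0.
apply/dual_cvgP => x; apply: cvg_near_cst.
have [s sx] := ps_fixed_ex x; exists s => // t /= st.
by rewrite (ps_fixed st sx).
Qed.

Lemma adjoint_dual_ball s (f : dual V) :
  dual_ball V f -> dual_ball V (adjoint (P s) f).
Proof.
move=> /dual_ballP fB; apply/dual_ballP => x /=.
exact: le_trans (fB _) (ps_contraction s x).
Qed.

(** [f \o P s] converges to [f], being eventually constant at each point. *)
Lemma induced_dual_ball_dense (f : dual V) : dual_ball V f ->
  closure (D `&` dual_ball V) f.
Proof.
move=> fB A /adjoint_tails_cvg [s _ sA]; exists (adjoint (P s) f).
split; last by apply: sA => /=.
by split; [exists s => //; exists f|exact: adjoint_dual_ball].
Qed.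

End Projectional.

(** * From projections to retractions *)

Section Dual_ball.
Context {R : realType}.

Lemma dual_ball_space_compact (V : normedModType R) :
  compact [set: dual_ball_space V].
Proof. exact: set_type_compact (@banach_alaoglu R V). Qed.

Lemma dual_ball_space_hausdorff (V : normedModType R) :
  hausdorff_space (dual_ball_space V).
Proof. exact: set_type_hausdorff (@dual_hausdorff R V). Qed.

Lemma dual_zero (V : normedModType R) :
  exists2 f : dual V, dual_ball V f & forall x, f x = 0.
Proof.
have [x|f fE f1] := @bounded_linear_dual R V \0 1; first by rewrite /= mul1r.
exists f => [|x]; last by rewrite fE.
by apply/dual_ballP => x; rewrite -[`|x|]mul1r.
Qed.

Lemma adjoint_continuous (V W : normedModType R) (T : bounded_op V W) :
  continuous (adjoint T).
Proof.
move=> f; have FF : Filter (adjoint T @ nbhs f) by exact: fmap_filter.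
by apply: (@dual_cvgP R V _ _ FF).2 => x; exact: (@dual_eval_continuous R W (T x) f).
Qed.

End Dual_ball.

Section Ball_retractions.
Context {R : realType} {V : completeNormedModType R}.
Context {disp : Order.disp_t} {G : porderType disp} (P : G -> bounded_op V V).
Hypothesis Psk : r_projectional_skeleton 1 P.
Let ps := Psk.1.

Definition ball_retraction (s : G) (f : dual_ball_space V) : dual_ball_space V :=
  exist _ (adjoint (P s) (set_val f))
    (mem_set (adjoint_dual_ball Psk s (set_mem (valP f)))).

Lemma ball_retraction_continuous s : continuous (ball_retraction s).
Proof.
apply: set_type_continuous => f.
apply: (@continuous_comp _ _ _ set_val (adjoint (P s))).
  exact: set_val_continuous.
exact: adjoint_continuous.
Qed.

Lemma ball_retraction_metrizable s :
  metrizable R (set_type (range (ball_retraction s))).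
Proof.
have r0 : range (P s) !=set0 by exists (P s 0), 0.
have [c [Pc cd]] := separable_sequence r0 (ps_separable ps s).
(* Rescaling the dense sequence to [1 / (n + 1)] bounds the values of the
   functionals of the dual ball. *)
pose a n : R := (n.+1%:R * (1 + `|c n|))^-1.
have a0 n : 0 < a n by rewrite invr_gt0 mulr_gt0// ltr_pwDl.
pose h n (f : set_type (range (ball_retraction s))) : R :=
  set_val (set_val f) (a n *: c n).
apply: (@compact_metrizable _ _ h).
- apply/set_type_compact/continuous_compact; last exact: dual_ball_space_compact.
  by apply/continuous_subspaceT; exact: ball_retraction_continuous.
- move=> n f; apply: (@continuous_comp _ _ _ (set_val \o set_val)
    (fun g : dual V => g (a n *: c n) : R)); last exact: dual_eval_continuous.
  by apply: continuous_comp; exact: set_val_continuous.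
- move=> n f; have /dual_ballP fB := set_mem (valP (set_val f)).
  apply: le_trans (fB _) _; rewrite normrZ gtr0_norm// /a invfM -mulrA.
  rewrite ler_piMr// ler_pdivrMl ?ltr_pwDl// mulr1.
  by rewrite lerDr.
move=> f g fg; apply/val_inj/val_inj/bounded_op_ext => x.
have fgc n : set_val (set_val f) (c n) = set_val (set_val g) (c n).
  have := fg n; rewrite /h !linearZ /= => /(congr1 ( *%R (a n)^-1)).
  by rewrite !mulKf// gt_eqF.
have fixed (k : set_type (range (ball_retraction s))) y :
    set_val (set_val k) (P s y) = set_val (set_val k) y.
  have [k' _ kE] := set_mem (valP k).
  have -> : set_val k = ball_retraction s k' by exact/esym.
  by rewrite /= (ps_projection ps).
rewrite -(fixed f) -(fixed g); apply/eqP; rewrite -subr_eq0 -normr_le0.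
apply/ler_addgt0Pr => e e0; rewrite add0r.
have e2 : 0 < e / 2 by rewrite divr_gt0.
have [n xn] := cd (P s x) _ (imageT (P s) x) e2.
have /dual_ballP fB := set_mem (valP (set_val f)).
have /dual_ballP gB := set_mem (valP (set_val g)).
have := le_trans (fB (P s x - c n)) (ltW xn).
have := le_trans (gB (P s x - c n)) (ltW xn).
rewrite !linearB fgc => h1 h2.
have := ler_distD (set_val (set_val g) (c n)) (set_val (set_val f) (P s x))
  (set_val (set_val g) (P s x)).
rewrite (distrC (set_val (set_val g) (c n))).
by move: h1 h2; lra.
Qed.

Theorem ball_retractional_skeleton :
  retractional_skeleton (R := R) ball_retraction.
Proof.
split.
- exact: (ps_directed ps).
- exact: (ps_sigma_complete ps).
- exact: ball_retraction_continuous.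
- move=> s f; apply/val_inj/bounded_op_ext => x /=.
  by rewrite (ps_projection ps).
- exact: ball_retraction_metrizable.
- move=> f; have [s0] := ps_index Psk.
  have PF := tails_filter (ps_directed ps) s0.
  by apply: set_type_cvg; exact: adjoint_tails_cvg.
- move=> s t st f; split; apply/val_inj/bounded_op_ext => x /=.
    by rewrite -(ps_commute ps st x).2.
  by rewrite -(ps_commute ps st x).1.
- move=> s t ss st f; apply: set_type_cvg; apply/dual_cvgP => x /=.
  have si : ascending s by move=> n; exact/ltW/ss.
  have Px : P (s n) x @[n --> \oo] --> P t x by exact: (ps_sup_cvg Psk).
  exact: cvg_comp _ _ Px (@bounded_op_continuous _ _ _ (set_val f) (P t x)).
Qed.

Lemma induced_by_ball_retractions :
  in_dual_ball (induced_by_projections P) = induced_by_retractions ball_retraction.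
Proof.
apply/seteqP; split=> f.
  move=> /(induced_dualP Psk)[s fs]; exists s => //; exists f => //.
  by apply/val_inj/bounded_op_ext => x /=; exact: fs.
by move=> [s _ [g _ <-]]; exists s => //; exists (set_val g).
Qed.

End Ball_retractions.

Theorem projectional_retractional (R : realType) (V : completeNormedModType R)
    (D : set (dual V)) :
  induced_by_r_projectional_skeleton 1 D ->
  induced_by_retractional_skeleton (R := R) (in_dual_ball D).
Proof.
move=> [disp [G [P [Psk ->]]]].
exists disp, G, (ball_retraction Psk).
by split; [exact: ball_retractional_skeleton|exact: induced_by_ball_retractions].
Qed.

(** * Restrictions to a subspace *)

Lemma eq_on_closure (T U : topologicalType) (a b : T -> U) (A : set T) (z : T) :
  hausdorff_space U -> continuous a -> continuous b ->
  (forall x, A x -> a x = b x) -> closure A z -> a z = b z.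
Proof.
move=> hU ca cb ab Az; apply: hU => B C azB bzC.
have aB : nbhs z (a @^-1` B) := ca z B azB.
have bC : nbhs z (b @^-1` C) := cb z C bzC.
have [w [Aw [/= Bw Cw]]] := Az _ (filterI aB bC).
by exists (a w); split => //; rewrite ab.
Qed.

Lemma sigma_cvgP (R : realType) (X : normedModType R) (D : set (dual X))
    (F : set_system X) (x : X) : Filter F ->
  F --> (x : sigma_space D) <->
  forall d : set_type D, F --> (x : initial_topology (set_val d : X -> R^o)).
Proof.
exact: (@cvg_sup X (set_type D) (fun d : set_type D =>
  Topological.class (initial_topology (set_val d : X -> R^o)))).
Qed.

Lemma sigma_eval_continuous (R : realType) (X : normedModType R)
    (D : set (dual X)) (d : dual X) :
  D d -> continuous (d : sigma_space D -> R^o).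
Proof.
move=> Dd x.
pose i : set_type D := exist _ d (mem_set Dd).
pose T := initial_topology (d : X -> R^o).
have Tx : nbhs (x : sigma_space D) --> (x : T).
  have xF := @nbhs_filter (sigma_space D) x.
  exact: ((sigma_cvgP D x xF).1 (fun A => id) i).
apply: cvg_trans (@initial_continuous X R^o d x).
by move=> A; exact: Tx.
Qed.

Section Restricted_dual_ball.
Context {R : realType} {X : completeNormedModType R} (Y : closed_subspace X).
Context {disp : Order.disp_t} {G : porderType disp} (P : G -> bounded_op X X).
Hypothesis Psk : r_projectional_skeleton 1 P.
Let D := induced_by_projections P.
Let DB := D `&` dual_ball X.

Lemma restriction_continuous : continuous (restriction Y).
Proof. exact: adjoint_continuous. Qed.

Definition ball_restriction (f : dual_ball_space X) :
    dual_ball_space (subspace_type Y) :=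
  exist _ (restriction Y (set_val f))
    (mem_set (restriction_dual_ball (imageP _ (set_mem (valP f))))).

Lemma ball_restriction_continuous : continuous ball_restriction.
Proof.
apply: set_type_continuous => f.
apply: (@continuous_comp _ _ _ set_val (restriction Y)).
  exact: set_val_continuous.
exact: restriction_continuous.
Qed.

Lemma induced_ball_dense (f : dual_ball_space X) : closure (in_dual_ball D) f.
Proof.
move=> A /set_type_nbhs[B fB BA].
have [g [[Dg gB] Bg]] := induced_dual_ball_dense Psk (set_mem (valP f)) fB.
by exists (exist _ g (mem_set gB)); split; [exact: Dg|exact: BA].
Qed.

Lemma ball_restriction_surjective (f : dual_ball_space (subspace_type Y)) :
  exists F, ball_restriction F = f.
Proof.
have /dual_ballP fB := set_mem (valP f).
have [|g gf gB] := @hahn_banach _ _ Y (set_val f) 1 ler01.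
  by move=> y; rewrite mul1r.
have {}gB : dual_ball X g by apply/dual_ballP => x; rewrite -[`|x|]mul1r.
by exists (exist _ g (mem_set gB)); apply: val_inj.
Qed.

Lemma restricted_ball_dense (f : dual_ball_space (subspace_type Y)) :
  closure (in_dual_ball (restriction Y @` DB)) f.
Proof.
have [F <-] := ball_restriction_surjective f.
move=> A /ball_restriction_continuous /induced_ball_dense [g [Dg Ag]].
exists (ball_restriction g); split => //.
by exists (set_val g) => //; split=> //; exact/set_mem/valP.
Qed.

Section From_retractions.
Context {disp' : Order.disp_t} {H : porderType disp'}.
Context (r : H -> dual_ball_space (subspace_type Y) ->
                  dual_ball_space (subspace_type Y)).
Hypothesis rsk : retractional_skeleton (R := R) r.
Hypothesis rD : in_dual_ball (restriction Y @` D) = induced_by_retractions r.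

Let cK := @dual_ball_space_compact R (subspace_type Y).
Let hK := @dual_ball_space_hausdorff R (subspace_type Y).

(** An element of [D] that restricts to the dual ball of [Y] may have a large
    norm. But its restriction is the limit of a sequence of restrictions of
    elements of [DB], by density and the Frechet-Urysohn property, and a cluster
    point of these elements is an extension in [DB]. *)
Lemma restricted_ball_eq :
  in_dual_ball (restriction Y @` DB) = in_dual_ball (restriction Y @` D).
Proof.
apply/seteqP; split=> [f [d [Dd _] df]|f Df]; first by exists d.
have sub : in_dual_ball (restriction Y @` DB) `<=` induced_by_retractions r.
  by rewrite -rD => f' [d [Dd _] df]; exists d.
have Sf : induced_by_retractions r f by rewrite -rD.
have [a Da af] :=
  induced_frechet_urysohn cK hK rsk sub Sf (@restricted_ball_dense f).
have /choice[d dP] n : exists d, DB d /\ restriction Y d = set_val (a n).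
  have [d Dd dn] : (restriction Y @` DB) (set_val (a n)) := Da n.
  by exists d; split.
have [F FU oF] := ultra_eventually.
have [e De de] := induced_dual_countably_compact Psk FU (fun n => (dP n).1).
exists e => //.
have h := cvg_comp _ _ de (@restriction_continuous e).
apply: (cvg_unique (@dual_hausdorff _ _) h).
have -> : restriction Y \o d = set_val \o a.
  by apply/funext => n /=; exact: (dP n).2.
have aF : a @ F --> f := cvg_trans (cvg_app a oF) af.
exact: cvg_comp _ _ aF (@set_val_continuous _ _ f).
Qed.

Lemma restricted_stone_cech : stone_cech (in_dual_ball (restriction Y @` DB)).
Proof.
have [z zB _] := @dual_zero R (subspace_type Y).
rewrite restricted_ball_eq rD.
exact: (induced_stone_cech (exist _ z (mem_set zB) : dual_ball_space _) cK hK rsk).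
Qed.

Lemma restricted_frechet_urysohn :
  frechet_urysohn (set_type (restriction Y @` DB)).
Proof.
have valB (p : set_type (restriction Y @` DB)) :
    dual_ball (subspace_type Y) (set_val p).
  apply: restriction_dual_ball; have [d [_ dB] dp] := set_mem (valP p).
  by exists d.
pose k p : dual_ball_space (subspace_type Y) :=
  exist _ (set_val p) (mem_set (valB p)).
move=> A x Ax.
have subS : k @` A `<=` induced_by_retractions r.
  rewrite -rD => _ [p _ <-]; have [d [Dd _] dp] := set_mem (valP p).
  by exists d.
have Sx : induced_by_retractions r (k x).
  rewrite -rD; have [d [Dd _] dp] := set_mem (valP x).
  by exists d.
have [|a Aa ax] := induced_frechet_urysohn cK hK rsk subS Sx.
  move=> B /set_type_nbhs[C xC CB].
  have [p [Ap Cp]] := Ax _ (@set_val_continuous _ _ x C xC).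
  by exists (k p); split; [exists p|exact: CB].
have /choice[u uP] n : exists p, A p /\ k p = a n.
  by have [p Ap kp] := Aa n; exists p.
exists u => [n|]; first exact: (uP n).1.
apply: set_type_cvg.
have -> : set_val \o u = set_val \o a by apply/funext => n /=; rewrite -(uP n).2.
exact: cvg_comp _ _ ax (@set_val_continuous _ _ (k x)).
Qed.

End From_retractions.

Let g (d : set_type DB) := restriction Y (set_val d).

Lemma restricted_continuous : continuous g.
Proof.
move=> d; apply: (@continuous_comp _ _ _ set_val (restriction Y)).
  exact: set_val_continuous.
exact: restriction_continuous.
Qed.

Lemma range_restricted : range g = restriction Y @` DB.
Proof.
apply/seteqP; split=> [_ [d _ <-]|_ [d Dd <-]].
  by exists (set_val d) => //; exact/set_mem/valP.
by exists (exist _ d (mem_set Dd)).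
Qed.

Lemma frechet_urysohn_restricted_quotient :
  frechet_urysohn (set_type (restriction Y @` DB)) -> quotient_onto_image g.
Proof.
rewrite -range_restricted => fu.
apply: frechet_urysohn_quotient fu _; first exact: restricted_continuous.
  exact: dual_hausdorff.
move=> F u FU; have [n|d Dd ud] :=
    induced_dual_countably_compact (u := set_val \o u) Psk FU.
  exact/set_mem/valP.
by exists (exist _ d (mem_set Dd)); exact: set_type_cvg.
Qed.

Lemma sigma_closure_annihilator (x : X) :
  closure (carrier Y : set (sigma_space D)) x ->
  forall d, D d -> (forall y, carrier Y y -> d y = 0) -> d x = 0.
Proof.
move=> Yx d Dd dY.
exact: (@eq_on_closure (sigma_space D) R^o d (fun=> 0) _ x
  (@norm_hausdorff R R^o) (sigma_eval_continuous Dd) (@cst_continuous _ _ _) dY Yx).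
Qed.

(** The value at [x] of an element of [DB] is a function [phi] of its
    restriction to [Y]. The quotient property makes [phi] continuous, so that it
    extends to a function [h] of the dual ball of [Y], and [h (restriction Y f)]
    equals [f x] for all [f] in the dual ball of [X], by density of [DB]. *)
Lemma quotient_sigma_closed :
  stone_cech (in_dual_ball (restriction Y @` DB)) -> quotient_onto_image g ->
  sigma_closed D Y.
Proof.
move=> [_ _ _ sc] [_ qg] x Yx; apply: contrapT => nYx.
have Dx := sigma_closure_annihilator Yx.
have gx d e : DB d -> DB e -> restriction Y d = restriction Y e -> d x = e x.
  move=> [Dd _] [De _] de.
  have [h Dh hE] := induced_dual_linear Psk (-1) De Dd.
  have /eqP : h x = 0.
    apply: Dx => // y Yy; rewrite hE mulN1r.
    have := congr1 (fun f : dual (subspace_type Y) => f (Sub y (mem_set Yy))) de.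
    by rewrite /= => ->; rewrite addNr.
  by rewrite hE mulN1r addrC subr_eq0 => /eqP.
pose C := set_type `[- `|x|, `|x|].
have /choice[phi phiP] (p : set_type (range g)) : exists c : C,
    forall d, DB d -> restriction Y d = set_val p -> set_val c = d x.
  have [[d dD] _ dp] := set_mem (valP p).
  have [Dd dB] := set_mem dD.
  have dx : d x \in `[- `|x|, `|x|].
    by rewrite in_itv /= -ler_norml; exact: (dual_ballP d).1.
  exists (exist _ (d x) (mem_set dx)) => e De ep.
  by apply: gx => //; rewrite ep; exact: dp.
have phig (d : set_type DB) : set_val (phi (corestrict g d)) = set_val d x.
  by apply: phiP => //; exact/set_mem/valP.
have cphi : continuous phi.
  apply/continuousP => U oU; apply/qg.
  have cpg : continuous (phi \o corestrict g).
    apply: set_type_continuous.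
    have -> : set_val \o (phi \o corestrict g) =
        (fun f : dual X => f x : R) \o set_val.
      by apply/funext => d /=; exact: phig.
    move=> d; apply: continuous_comp; first exact: set_val_continuous.
    exact: dual_eval_continuous.
  exact: open_comp (fun d _ => cpg d) oU.
have sub (k : set_type (in_dual_ball (restriction Y @` DB))) :
    range g (set_val (set_val k)).
  by rewrite range_restricted; exact: (set_mem (valP k)).
pose i k : set_type (range g) := exist _ (set_val (set_val k)) (mem_set (sub k)).
have ci : continuous i.
  apply: set_type_continuous => k.
  by apply: (@continuous_comp _ _ _ set_val set_val); exact: set_val_continuous.
have [|||h ch hE] := sc C (phi \o i).
- exact/set_type_compact/segment_compact.
- exact/set_type_hausdorff/norm_hausdorff.
- by move=> k; apply: continuous_comp; [exact: ci|exact: cphi].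
have hF (F : dual_ball_space X) : set_val (h (ball_restriction F)) = set_val F x.
  apply: (@eq_on_closure _ _ (set_val \o (h \o ball_restriction))
    (fun F : dual_ball_space X => set_val F x : R) (in_dual_ball D)).
  - exact: norm_hausdorff.
  - move=> z; apply: continuous_comp; last exact: set_val_continuous.
    by apply: continuous_comp; [exact: ball_restriction_continuous|exact: ch].
  - move=> z; apply: (@continuous_comp _ _ _ set_val (fun f : dual X => f x : R)).
      exact: set_val_continuous.
    exact: dual_eval_continuous.
  - move=> f Df /=.
    have DBf : DB (set_val f) by split=> //; exact/set_mem/valP.
    have Sf : in_dual_ball (restriction Y @` DB) (ball_restriction f).
      by exists (set_val f).
    have := hE (exist _ (ball_restriction f) (mem_set Sf)).
    rewrite /= => ->; exact: phiP.
  - exact: induced_ball_dense.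
have [f [fY fx f1]] := hahn_banach_separation nYx.
have fB : dual_ball X f by apply/dual_ballP.
have [z zB z0] := @dual_zero R X.
move/eqP: fx; apply; rewrite -(z0 x).
have <- := hF (exist _ f (mem_set fB)); have <- := hF (exist _ z (mem_set zB)).
congr (set_val (h _)); apply/val_inj/bounded_op_ext => y /=.
by rewrite z0 fY//; exact/set_mem/valP.
Qed.

End Restricted_dual_ball.

(** * From sigma-closed subspaces to projections *)

Section Sigma_closed.
Context {R : realType} {X : completeNormedModType R} (D : set (dual X)).
Hypothesis Dlin : forall (a : R) f g, D f -> D g ->
  exists2 h : dual X, D h & forall x, h x = a * f x + g x.

(** By induction on [l]: if its head [d] takes the value 1 at some [y] in [Z],
    apply the induction hypothesis to the kernel of [d] in [Z] and to the point
    [x - d x *: y], then add [d x *: y] back. *)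
Lemma finite_interpolation (l : seq (dual X)) (Z : set X) (x : X) :
  (forall d, d \in l -> D d) ->
  Z 0 -> (forall (a : R) y z, Z y -> Z z -> Z (a *: y + z)) ->
  (forall d, D d -> (forall z, Z z -> d z = 0) -> d x = 0) ->
  exists2 z, Z z & forall d, d \in l -> d z = d x.
Proof.
elim: l Z x => [|d l IH] Z x lD Z0 Zlin Zx; first by exists 0.
have lD' e : e \in l -> D e by move=> el; apply: lD; rewrite inE el orbT.
have Dd : D d by apply: lD; rewrite inE eqxx.
have [dZ|/existsNP[y0 /not_implyP[Zy0 dy0]]] := pselect (forall z, Z z -> d z = 0).
  have [z Zz zl] := IH Z x lD' Z0 Zlin Zx; exists z => // e.
  by rewrite inE => /orP[/eqP ->|/zl //]; rewrite dZ// Zx.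
have ZZ (a : R) y : Z y -> Z (a *: y).
  by move=> ?; rewrite -[_ *: _]addr0; exact: Zlin.
have [y Zy dy] : exists2 y, Z y & d y = 1.
  exists ((d y0)^-1 *: y0); first exact: ZZ.
  by rewrite dualZ mulVf//; exact/eqP.
pose Z' := Z `&` [set z | d z = 0].
have [|||z [Zz dz] zl] := IH Z' (x - d x *: y) lD'.
- by split => //=; rewrite linear0.
- move=> a z w [Zz /= dz] [Zw /= dw]; split; first exact: Zlin.
  by rewrite /= dual_linear dz dw addr0 mulr0.
- move=> e De eZ'.
  have [h Dh hE] := Dlin (- e y) Dd De.
  have hx : h x = 0.
    apply: Zx => // z Zz; rewrite hE.
    have : e (- d z *: y + z) = 0.
      apply: eZ'; split; first exact: Zlin.
      by rewrite /= dual_linear dy mulr1 addNr.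
    by rewrite dual_linear mulNr mulrC -mulNr.
  move: hx; rewrite hE linearB dualZ.
  by rewrite mulNr addrC mulrC.
exists (d x *: y + z); first exact: Zlin.
move=> e; rewrite inE => /orP[/eqP ->|/zl ez].
  by rewrite dual_linear dy dz addr0 mulr1.
by rewrite dual_linear ez linearB dualZ addrC subrK.
Qed.

Variable Y : closed_subspace X.

(** By interpolation, the sets of points of [Y] at which the elements of a finite
    list take the same values as at [x] form a proper filter base; it converges
    to [x] in the sigma-topology. *)
Lemma sigma_closed_separation (x : X) : sigma_closed D Y ->
  (forall d, D d -> (forall y, carrier Y y -> d y = 0) -> d x = 0) ->
  carrier Y x.
Proof.
move=> cY Yx; apply: cY.
have Y0 : carrier Y 0 by exact/set_mem/(carrier_linear Y).1.
have Ylin (a : R) y z : carrier Y y -> carrier Y z -> carrier Y (a *: y + z).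
  by move=> /mem_set Yy /mem_set Yz; exact/set_mem/(carrier_linear Y).2.
pose B (l : seq (dual X)) :=
  [set z | carrier Y z /\ forall d, d \in l -> d z = d x].
pose F := filter_from [set l : seq (dual X) | forall d, d \in l -> D d] B.
have FF : Filter F.
  apply: filter_from_filter; first by exists [::].
  move=> l m lD mD; exists (l ++ m) => [d|z [Yz zlm]].
    by rewrite mem_cat => /orP[/lD|/mD].
  by split; split=> // d dl; apply: zlm; rewrite mem_cat dl ?orbT.
have Fx : F --> (x : sigma_space D).
  apply/sigma_cvgP => d A; rewrite /nbhs /= => -[_ [[U oU <-] Ux] UA].
  exists [:: set_val d] => [e|z [_ zd]].
    by rewrite inE => /eqP ->; exact/set_mem/valP.
  by apply: UA; rewrite /= (zd (set_val d)) ?inE.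
move=> A /Fx [l lD BA].
have [z Yz zl] := finite_interpolation lD Y0 Ylin Yx.
by exists z; split => //; exact: BA.
Qed.

End Sigma_closed.

Section Invariant_subspaces.
Context {R : realType} {X : completeNormedModType R} (Y : closed_subspace X).
Context {disp : Order.disp_t} {G : porderType disp} (P : G -> bounded_op X X).
Hypothesis Psk : r_projectional_skeleton 1 P.
Let ps := Psk.1.
Let D := induced_by_projections P.
Hypothesis cY : sigma_closed D Y.

Let F := [set d | [/\ D d, forall y, carrier Y y -> d y = 0 & dual_ball X d]].

(** One functional, nearly attaining the supremum, controls all of [F] at [a]. *)
Lemma annihilator_half_norming (a : X) :
  exists2 f, F f & forall d, F d -> `|d a| <= 2 * `|f a|.
Proof.
have [z zB z0] := @dual_zero R X.
have Fz : F z.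
  have [s] := ps_index Psk.
  by split=> //; apply/(induced_dualP Psk); exists s => x; rewrite !z0.
pose E := [set `|d a| | d in F].
have supE : has_sup E.
  split; first by exists `|z a|, z.
  by exists `|a| => _ [d [_ _ /dual_ballP dB] <-].
have [E0|E0] := leP (sup E) 0.
  exists z => // d Fd; rewrite z0 normr0 mulr0; apply: le_trans E0.
  by apply: ub_le_sup; [exact: supE.2|exists d].
have h0 : 0 < sup E / 2 by rewrite divr_gt0.
have [_ [f Ff <-] fE] := sup_adherent h0 supE.
exists f => // d Fd; apply: (@le_trans _ _ (sup E)); last by lra.
by apply: ub_le_sup; [exact: supE.2|exists d].
Qed.

Definition invariant (s : G) : Prop := forall y, carrier Y y -> carrier Y (P s y).

(** Each [s n.+1] is chosen to carry the almost norming functional [f a] for all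
    [a] in a sequence dense in the range of [P (s n)]. Let [t] be the supremum
    and [z = P t y] with [y] in [Y]. Then [f a] vanishes at [z], being carried by
    [t] and zero at [y]. If [a] is close to [z], then [f a] is small at [a], so
    that all of [F] is small at [a] and at [z]. Hence [F] vanishes at [z], and
    [z] is in [Y] because [F] separates points from [Y]. *)
Lemma invariant_cofinal (s0 : G) : exists2 t, (s0 <= t)%O & invariant t.
Proof.
have /choice[f fP] a : exists f, F f /\ forall d, F d -> `|d a| <= 2 * `|f a|.
  by have [f ? ?] := annihilator_half_norming a; exists f.
have /choice[c cP] s : exists c : nat -> X, forall x e, 0 < e -> P s x = x ->
    exists n, `|x - c n| < e.
  have r0 : range (P s) !=set0 by exists (P s 0), 0.
  have [c [_ cd]] := separable_sequence r0 (ps_separable ps s).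
  by exists c => x e e0 sx; apply: cd => //; exists x.
have /choice[nxt nxtP] s : exists s', (s <= s')%O /\
    forall n x, f (c s n) (P s' x) = f (c s n) x.
  have /choice[u uP] n : exists u, forall x, f (c s n) (P u x) = f (c s n) x.
    by apply/(induced_dualP Psk); case: (fP (c s n)) => -[].
  have [v vP] := countable_upper_bound (ps_directed ps) (ps_sigma_complete ps)
    (fun n => if n is m.+1 then u m else s).
  exists v; split=> [|n]; first exact: (vP 0%N).
  exact: (ps_support_le Psk (vP n.+1) (uP n)).
pose s n := iter n nxt s0.
have si : ascending s by move=> n; exact: (nxtP _).1.
have [t st] := ps_sigma_complete ps si.
exists t => [|y Yy]; first exact: (st.1 0%N).
apply: (sigma_closed_separation (@induced_dual_linear _ _ _ _ _ Psk) cY).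
move=> d Dd dY.
have Fz d' : F d' -> d' (P t y) = 0.
  move=> Fd'; have [_ _ /dual_ballP d'B] := Fd'.
  apply/eqP; rewrite -normr_le0; apply/ler_addgt0Pr => e e0; rewrite add0r.
  have e6 : 0 < e / 6 by rewrite divr_gt0.
  have [n [w [nw zw]]] := ps_sup_approx Psk y si st e6.
  have [m wm] := cP (s n) w _ e6 nw.
  set a := c (s n) m in wm; set z := P t y in zw *.
  have [[Df fY /dual_ballP fB] fmax] := fP a.
  have fz : f a z = 0.
    rewrite -(fY y Yy); apply: (ps_support_le Psk (st.1 n.+1)).
    exact: (nxtP (s n)).2.
  have za : `|z - a| < e / 3.
    by have := ler_distD w z a; lra.
  have fa : `|f a a| <= `|z - a|.
    by have := fB (a - z); rewrite linearB fz subr0 distrC.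
  have da : `|d' (z - a)| <= `|z - a| := d'B _.
  have -> : d' z = d' (z - a) + d' a by rewrite linearB subrK.
  have := ler_normD (d' (z - a)) (d' a); have := fmax _ Fd'; lra.
have [k k0 dk] := bounded_op_bound d.
have [w wB w0] := @dual_zero R X.
have Dw : D w.
  by apply/(induced_dualP Psk); exists t => x; rewrite !w0.
have [h Dh hE] := induced_dual_linear Psk k^-1 Dd Dw.
have : h (P t y) = 0.
  apply: Fz; split=> // [z Yz|]; first by rewrite hE w0 dY// mulr0 addr0.
  apply/dual_ballP => z; rewrite hE w0 addr0 normrM gtr0_norm ?invr_gt0//.
  by rewrite ler_pdivrMl.
rewrite hE w0 addr0 => /eqP; rewrite mulf_eq0 invr_eq0 gt_eqF//=.
by move=> /eqP.
Qed.

Lemma invariant_sup (s : nat -> G) (t : G) : ascending s -> is_supremum s t ->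
  (forall n, invariant (s n)) -> invariant t.
Proof.
move=> si st sinv y Yy.
have h : P (s n) y @[n --> \oo] --> P t y by exact: (ps_sup_cvg Psk).
apply: (closed_cvg _ (@carrier_closed _ _ Y) _ _ h).
by apply: nearW => n; exact: sinv.
Qed.

Lemma restricted_op (T : bounded_op X X) :
  (forall y, carrier Y y -> carrier Y (T y)) ->
  exists T' : bounded_op (subspace_type Y) (subspace_type Y),
    forall y, val (T' y) = T (val y).
Proof.
move=> TY.
pose f (y : subspace_type Y) : subspace_type Y :=
  Sub (T (val y)) (mem_set (TY _ (set_mem (valP y)))).
have fl : linear f by move=> a x y; apply: val_inj; rewrite /= !linearP.
pose L : {linear subspace_type Y -> subspace_type Y} :=
  HB.pack f (GRing.isLinear.Build R _ _ *:%R f fl).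
have cL : continuous L.
  move=> y; have FF : Filter (L @ nbhs y) by apply: fmap_filter; exact: nbhs_filter.
  apply: (isometry_cvg _ FF (subspace_valB (Y := Y))).1.
  have h : (T \o val) @ y --> T (val y).
    apply: continuous_comp; first exact: subspace_val_continuous.
    exact: bounded_op_continuous.
  exact: h.
by exists (BoundedOp cL).
Qed.


Let sub := {s : G | `[< invariant s >]}.
Let G' : porderType disp := sub_type (sub : subType _).

(** The indices [t] with [invariant t] form the index set. A functional on [Y]
    carried by such a [t] extends to [X] by the Hahn-Banach theorem; composed
    with [P t], the extension lies in [D] and still extends the functional. *)
Theorem sigma_closed_projectional :
  induced_by_r_projectional_skeleton 1 (restriction Y @` D).
Proof.
have leE (s t : G') : (s <= t)%O = (val s <= val t)%O by [].
have inv (s : G') : invariant (val s) by exact/asboolP/(valP s).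
have mk t : invariant t -> exists s : G', val s = t.
  by move=> /asboolP it; exists (exist _ t it).
have cof s0 : exists t : G', (s0 <= val t)%O.
  by have [t st /mk[t' t'E]] := invariant_cofinal s0; exists t'; rewrite t'E.
have /choice[Q QP] (s : G') :
    exists T' : bounded_op (subspace_type Y) (subspace_type Y), forall y, val (T' y) = P (val s) (val y).
  exact: restricted_op (inv s).
have sup_val (s : nat -> G') (t : G') : ascending s -> is_supremum s t ->
    is_supremum (fun n => val (s n)) (val t).
  move=> si st; have si' : ascending (fun n => val (s n)) by [].
  have [u uS] := ps_sigma_complete ps si'.
  have [u' u'E] := mk u (invariant_sup si' uS (fun n => inv (s n))).
  suff <- : u = val t by [].
  apply/eqP; rewrite eq_le uS.2 => [/=|n]; last exact: st.1.
  by rewrite -u'E -leE; apply: st.2 => n; rewrite leE u'E; exact: uS.1.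
have Qidem s y : Q s (Q s y) = Q s y.
  by apply: val_inj; rewrite !QP (ps_projection ps).
have Qsk : r_projectional_skeleton 1 Q.
  split; last first.
    move=> s; apply/opnorm_le1P => y.
    by have := ps_contraction Psk (val s) (val y); rewrite -QP.
  split.
  - move=> s t; have [u [su tu]] := ps_directed ps (val s) (val t).
    have [v uv] := cof u; exists v; rewrite !leE.
    by split; [exact: le_trans su uv|exact: le_trans tu uv].
  - move=> s si; have si' : ascending (fun n => val (s n)) by [].
    have [u uS] := ps_sigma_complete ps si'.
    have [u' u'E] := mk u (invariant_sup si' uS (fun n => inv (s n))).
    exists u'; split=> [n|v sv]; rewrite leE u'E; first exact: uS.1.
    by apply: uS.2 => n; exact: sv.
  - exact: Qidem.
  - move=> s; have r0 : range (P (val s)) !=set0 by exists (P (val s) 0), 0.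
    have [c [_ cd]] := separable_sequence r0 (ps_separable ps (val s)).
    apply: (@isometry_sequence_separable R X (subspace_type Y)
      (fun y => val y) _ c).
    + by exists (Q s 0), 0.
    + exact: subspace_valB.
    + move=> _ e [y _ <-] e0; rewrite QP; exact: cd.
  - rewrite -subTset => y _; have [s sy] := ps_fixed_ex Psk (val y).
    have [t st] := cof s; exists t => //; exists y => //.
    by apply: val_inj; rewrite QP (ps_fixed Psk st sy).
  - move=> s t st y; split; apply: val_inj; rewrite !QP.
      exact: (ps_commute ps st _).1.
    exact: (ps_commute ps st _).2.
  - move=> s t ss st; have si : ascending s by move=> n; exact/ltW/ss.
    have st' := sup_val s t si st.
    apply/seteqP; split=> [_ [y _ <-] A QA|y cy].
      have h : val (Q (s n) y) @[n --> \oo] --> val (Q t y).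
        rewrite QP; under eq_fun do rewrite QP.
        exact: (@ps_sup_cvg _ _ _ _ _ Psk (fun n => val (s n))).
      have {}h : Q (s n) y @[n --> \oo] --> Q t y.
        exact: (isometry_cvg _ _ (subspace_valB (Y := Y))).1 h.
      have [N _ NA] := h A QA.
      exists (Q (s N) y); split; first by exists N => //; exists y.
      exact: (NA N (leqnn N)).
    exists y => //.
    apply: (@eq_on_closure _ _ (Q t) id _ y (@norm_hausdorff _ _)) cy => //.
      exact: bounded_op_continuous.
      by move=> z.
    move=> _ [n _ [z _ <-]]; apply: val_inj; rewrite !QP.
    by rewrite -(ps_commute ps (st'.1 n) _).2.
exists disp, G', Q; split=> //.
apply/seteqP; split=> g.
  move=> [d /(induced_dualP Psk)[s ds] <-]; apply/(induced_dualP Qsk).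
  have [t st] := cof s; exists t => y.
  by rewrite !restrictionE QP (ps_support_le Psk st ds).
move=> /(induced_dualP Qsk)[s gs].
have [k k0 gk] := bounded_op_bound g.
have [f fg _] := hahn_banach (ltW k0) gk.
exists (adjoint (P (val s)) f); first by exists (val s) => //; exists f.
apply: bounded_op_ext => y.
by rewrite -gs -fg !restrictionE QP.
Qed.

End Invariant_subspaces.

Theorem theorem4p6 (R : realType) (X : completeNormedModType R)
    (Y : closed_subspace X) (D : set (dual X)) :
  induced_by_r_projectional_skeleton 1%R D ->
  [<-> (* (i) *)
       induced_by_r_projectional_skeleton 1%R (restriction Y @` D);
       (* (ii) *)
       induced_by_retractional_skeleton (R := R)
         (in_dual_ball (restriction Y @` D));
       (* (iii) *)
       sigma_closed D Y;
       (* (iv) *)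
       stone_cech (in_dual_ball (restriction Y @` (D `&` dual_ball X)))
       /\ frechet_urysohn (set_type (restriction Y @` (D `&` dual_ball X)));
       (* (v) *)
       stone_cech (in_dual_ball (restriction Y @` (D `&` dual_ball X)))
       /\ quotient_onto_image
            (fun d : set_type (D `&` dual_ball X) => restriction Y (set_val d))].
Proof.
move=> [disp [G [P [Psk ->]]]].
have i_ii := @projectional_retractional R (subspace_type Y)
  (restriction Y @` induced_by_projections P).
have ii_iv : induced_by_retractional_skeleton (R := R)
    (in_dual_ball (restriction Y @` induced_by_projections P)) ->
    stone_cech (in_dual_ball
      (restriction Y @` (induced_by_projections P `&` dual_ball X))) /\
    frechet_urysohn (set_type
      (restriction Y @` (induced_by_projections P `&` dual_ball X))).
  move=> [disp' [H [r [rsk rD]]]].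
split; first exact (restricted_stone_cech Psk rsk rD).
exact (restricted_frechet_urysohn rsk rD).
have v_iii := @quotient_sigma_closed R X Y disp G P Psk.
have iii_i := @sigma_closed_projectional R X Y disp G P Psk.
have iv_v := @frechet_urysohn_restricted_quotient R X Y disp G P Psk.
tfae.
- exact: i_ii.
- move=> /ii_iv[sc fu]; exact: v_iii sc (iv_v fu).
- by move=> /iii_i /i_ii /ii_iv.
- by move=> [sc fu]; split; [|exact: iv_v].
- by move=> [sc qg]; apply/iii_i/v_iii.
Qed.
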